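(* Let $H$ be a finite dimensional Hopf algebra over a field $k$ with antipode $S$, and let $g\in H$ and $\alpha\in H^*$ be the distinguished grouplike elements of $H$ and $H^*$. Assume that $$S^2(h)=g^{-1}hg=\sum\alpha^{-1}(h_1)\alpha(h_3)h_2\qquad\text{for any }h\in H.$$ Then a finite dimensional right $H$-comodule algebra $A$ is $(H,\alpha)$-symmetric if and only if the smash product $A\# H^*$ is $(H^*,g)$-symmetric.
   Context: Distinguished grouplike elements: for a finite dimensional Hopf algebra $H$, $\alpha\in H^*$ is the character (algebra morphism $H\to k$) such that $th=\alpha(h)t$ for any left integral $t$ in $H$ (i.e. $ht=\varepsilon(h)t$ for all $h$) and any $h\in H$. The element $g\in H$ is the grouplike element such that $Th^*=h^*(g)T$ for any left integral $T$ on $H$ (i.e. $T\in H^*$ with $h^*T=h^*(1)T$ for all $h^*\in H^*$) and any $h^*\in H^*$. Via $H\simeq H^{**}$, $g$ is a character of $H^*$. Let $L$ be a Hopf algebra with antipode $S$. $L$ is cosovereign with sovereign character $u$ if $u:L\to k$ is an algebra morphism with $S^2(l)=\sum u^{-1}(l_1)u(l_3)l_2$ for all $l\in L$, where $u^{-1}=u\circ S$. (The assumptions of the claim say that $H$ is cosovereign with sovereign character $\alpha$ and that $H^*$ is cosovereign with sovereign character $g$.) A right $L$-comodule algebra is an algebra $B$ in the monoidal category $\mathcal{M}^L$ of right $L$-comodules, with coaction written $b\mapsto\sum b_0\otimes b_1$; $L^*$ acts on it by $l^*\cdot b=\sum l^*(b_1)b_0$. ${}_B\mathcal{M}^L_B$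 is the category of $B,B$-bimodules in $\mathcal{M}^L$ (both actions are $L$-colinear). For $B$ finite dimensional, let $F(B^* )$ be $B^*$ with right $L$-coaction determined by $\sum b^*_0(b)b^*_1=\sum b^*(b_0)S(b_1)$, right $B$-action $(b^*b)(c)=b^*(bc)$, and left $B$-action $(b*b^* )(c)=b^*(c(u^{-1}\cdot b))$. Then $F(B^* )\in{}_B\mathcal{M}^L_B$. Definition: a finite dimensional right $L$-comodule algebra $B$ is $(L,u)$-symmetric if $F(B^* )\simeq B$ in ${}_B\mathcal{M}^L_B$. The smash product $A\# H^*$ is $A\otimes H^*$ with multiplication $(a\# h^* )(b\# g^* )=\sum a(h^*_1\cdot b)\# h^*_2g^*$. It is a right $H^*$-comodule algebra with coaction $a\# h^*\mapsto\sum (a\# h^*_1)\otimes h^*_2$. *)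

(* Defs.v *)
(* Finite-dimensional Hopf algebras and comodule algebras over a field, on the
   Mathematical Components library. *)
From HB Require Import structures.
From mathcomp Require Import all_boot all_algebra falgebra.

Set Implicit Arguments.
Unset Strict Implicit.
Unset Printing Implicit Defensive.

Import GRing.Theory.
Local Open Scope ring_scope.

Reserved Notation "v \ox w" (at level 40, left associativity).
Reserved Notation "\sw_ ( x , y <- t ) F"
  (at level 36, F at level 36, x name, y name,
   format "'[' \sw_ ( x ,  y  <-  t ) '/  '  F ']'").

(* Functionals take their values in [k^o]; the casts [(f x : k) *: v] below make
   the scaling that of [k]. *)
Section Tensor.
Variable k : fieldType.

Definition dual (V : vectType k) : Type := 'Hom(V, k^o).
HB.instance Definition _ V := Vector.on (dual V).

(* [tens V W] is the space of coefficients on the products of the chosen bases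
   of [V] and [W]; [tens_lift] and [tens_liftE] give its universal property. *)
Definition tens (V W : vectType k) : Type := 'M[k]_(\dim {:V}, \dim {:W}).
HB.instance Definition _ V W := Vector.on (tens V W).

Definition ptens (V W : vectType k) (v : V) (w : W) : tens V W :=
  \matrix_(i, j) (coord (vbasis {:V}) i v * coord (vbasis {:W}) j w).

(* Meant for bilinear [f]. *)
Definition tens_lift (V W U : vectType k) (t : tens V W) (f : V -> W -> U) : U :=
  \sum_i \sum_j (t : 'M[k]_(_, _)) i j *: f (vbasis {:V})`_i (vbasis {:W})`_j.
End Tensor.

Notation "v \ox w" := (ptens v w) : ring_scope.
Notation "\sw_ ( x , y <- t ) F" := (tens_lift t (fun x y => F)) : ring_scope.

Section LinTheory.
Variable k : fieldType.
Implicit Types U V W X : vectType k.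

(* This is [linear f], unfolded. *)
Definition lin V W (f : V -> W) := forall a u v, f (a *: u + v) = a *: f u + f v.

Definition bilin V W U (f : V -> W -> U) :=
  (forall w, lin (f^~ w)) /\ (forall v, lin (f v)).

Lemma linE V W (f : V -> W) : lin f -> linfun f =1 f.
Proof.
move=> lf.
pose F : {linear V -> W} := HB.pack f (GRing.isLinear.Build k V W *:%R f lf).
exact: (lfunE F).
Qed.

Lemma lin_sum V W (f : V -> W) I (r : seq I) (P : pred I) F : lin f ->
  f (\sum_(i <- r | P i) F i) = \sum_(i <- r | P i) f (F i).
Proof.
move=> lf; rewrite -(linE lf) linear_sum.
by apply: eq_bigr => i _ /=; rewrite linE.
Qed.

Lemma linZ V W (f : V -> W) a v : lin f -> f (a *: v) = a *: f v.
Proof. by move=> lf; rewrite -(linE lf) linearZ /= linE. Qed.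

Lemma lin_tens V W U X (f : U -> X) (h : V -> W -> U) t : lin f ->
  f (\sw_(x, y <- t) h x y) = \sw_(x, y <- t) f (h x y).
Proof.
move=> lf; rewrite /tens_lift lin_sum //; apply: eq_bigr => i _.
by rewrite lin_sum //; apply: eq_bigr => j _; rewrite linZ.
Qed.

Lemma eq_tens V W U (f h : V -> W -> U) t :
  (forall x y, f x y = h x y) -> \sw_(x, y <- t) f x y = \sw_(x, y <- t) h x y.
Proof. by move=> e; apply: eq_bigr => i _; apply: eq_bigr => j _; rewrite e. Qed.

Lemma tens_lift_lin V W U (f : V -> W -> U) : lin (fun t : tens V W => tens_lift t f).
Proof.
move=> a s t; rewrite /tens_lift scaler_sumr -big_split; apply: eq_bigr => i _ /=.
rewrite scaler_sumr -big_split; apply: eq_bigr => j _ /=.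
by rewrite !mxE scalerDl scalerA.
Qed.

Lemma tens_liftE V W U (f : V -> W -> U) v w :
  bilin f -> \sw_(x, y <- v \ox w) f x y = f v w.
Proof.
case=> lfl lfr; rewrite [in RHS](coord_vbasis (memvf v)) (lin_sum _ _ _ (lfl w)).
apply: eq_bigr => i _; rewrite (linZ _ _ (lfl w)).
rewrite [in RHS](coord_vbasis (memvf w)) (lin_sum _ _ _ (lfr _)) scaler_sumr.
by apply: eq_bigr => j _; rewrite (linZ _ _ (lfr _)) mxE scalerA.
Qed.

Lemma tens_eta V W (t : tens V W) : \sw_(x, y <- t) (x \ox y) = t.
Proof.
apply/matrixP => i j; rewrite /tens_lift summxE (bigD1 i) //= summxE (bigD1 j) //=.
rewrite !mxE !coord_free ?(basis_free (vbasisP _)) // !eqxx !mulr1.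
rewrite big1 => [|l nl]; last first.
  rewrite !mxE !coord_free ?(basis_free (vbasisP _)) // eqxx.
  by rewrite (negPf nl) !mulr0.
rewrite big1 ?addr0 // => l nl; rewrite summxE big1 // => m _.
rewrite !mxE !coord_free ?(basis_free (vbasisP _)) //.
by rewrite (negPf nl) mul0r mulr0.
Qed.

Lemma lin_id V : lin (fun x : V => x). Proof. by []. Qed.
Lemma lin_lfun0 V W (f : 'Hom(V, W)) : lin f. Proof. exact: linearP. Qed.
Lemma lin_lfun U V W (f : 'Hom(V, W)) (e : U -> V) :
  lin e -> lin (fun x => f (e x)).
Proof. by move=> le a u v; rewrite le linearP. Qed.
Lemma lin_lfunl U V W (e : U -> 'Hom(V, W)) v : lin e -> lin (fun x => e x v).
Proof. by move=> le a x y; rewrite le !lfunE /= !lfunE. Qed.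
Lemma lin_duall U V (e : U -> dual V) v : 
  lin e -> lin (fun x => (e x : 'Hom(_, _)) v).
Proof. exact: lin_lfunl. Qed.
Lemma lin_scaler U V (e : U -> V) c : lin e -> lin (fun x => c *: e x).
Proof. by move=> le a x y; rewrite le scalerDr !scalerA mulrC. Qed.
Lemma lin_scalel U V (e : U -> k^o) (v : V) : lin e -> lin (fun x => (e x : k) *: v).
Proof. by move=> le a x y; rewrite le scalerDl scalerA. Qed.
Lemma lin_kmull U (e : U -> k^o) (v : k) : lin e -> lin (fun x => (e x * v) : k^o).
Proof. by move=> le a x y; rewrite le mulrDl -scalerAl. Qed.
Lemma lin_kmulr U (e : U -> k^o) (v : k) : lin e -> lin (fun x => (v * e x) : k^o).
Proof. by move=> le a x y; rewrite le mulrDr /GRing.scale /= mulrCA. Qed.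
Lemma lin_mull U (A : falgType k) (e : U -> A) v : lin e -> lin (fun x => e x * v).
Proof. by move=> le a x y; rewrite le mulrDl -scalerAl. Qed.
Lemma lin_mulr U (A : falgType k) (e : U -> A) v : lin e -> lin (fun x => v * e x).
Proof. by move=> le a x y; rewrite le mulrDr -scalerAr. Qed.
Lemma lin_oxl U V W (e : U -> V) (w : W) : lin e -> lin (fun x => e x \ox w).
Proof.
move=> le a x y; rewrite le; apply/matrixP => i j; rewrite !mxE.
by rewrite linearP mulrDl mulrA.
Qed.
Lemma lin_oxr U V W (e : U -> V) (w : W) : lin e -> lin (fun x => w \ox e x).
Proof.
move=> le a x y; rewrite le; apply/matrixP => i j; rewrite !mxE.
by rewrite linearP mulrDr mulrCA.
Qed.
Lemma lin_swb U V W X (e : U -> V -> W -> X) t :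
  (forall x y, lin (fun u => e u x y)) -> lin (fun u => \sw_(x, y <- t) e u x y).
Proof.
move=> le a u v; rewrite /tens_lift scaler_sumr -big_split; apply: eq_bigr => i _ /=.
rewrite scaler_sumr -big_split; apply: eq_bigr => j _ /=.
by rewrite le scalerDr !scalerA mulrC.
Qed.
Lemma lin_swa U V W X (e : V -> W -> X) (f : U -> tens V W) :
  lin f -> lin (fun u => \sw_(x, y <- f u) e x y).
Proof. by move=> lf a x y; rewrite lf tens_lift_lin. Qed.

Lemma lin_big U V I (r : seq I) (P : pred I) (F : I -> U -> V) :
  (forall i, P i -> lin (F i)) -> lin (fun u => \sum_(i <- r | P i) F i u).
Proof.
move=> lF a u v; rewrite scaler_sumr -big_split /=.
by apply: eq_bigr => i Pi; rewrite lF.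
Qed.
Lemma tens_big V W U I (r : seq I) (P : pred I) (F : I -> V -> W -> U) t :
  \sw_(x, y <- t) (\sum_(i <- r | P i) F i x y) =
  \sum_(i <- r | P i) \sw_(x, y <- t) F i x y.
Proof.
rewrite /tens_lift [RHS]exchange_big /=; apply: eq_bigr => i _.
rewrite [RHS]exchange_big /=; apply: eq_bigr => j _.
by rewrite scaler_sumr.
Qed.

Lemma lin_linfun U V W (e : U -> V -> W) : (forall v, lin (fun u => e u v)) ->
  (forall u, lin (e u)) -> lin (fun u => linfun (e u)).
Proof.
move=> l1 l2 a u v; apply/lfunP => x; rewrite linE // l1.
by rewrite add_lfunE scale_lfunE !linE.
Qed.

Lemma tens_tens V W V' W' U (f : V -> W -> U) (h : V' -> W' -> tens V W) t :
  \sw_(x, y <- \sw_(z, w <- t) h z w) f x y =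
  \sw_(z, w <- t) \sw_(x, y <- h z w) f x y.
Proof. exact: (lin_tens _ _ (tens_lift_lin f)). Qed.

Lemma lin_ext V W U (f h : tens V W -> U) : lin f -> lin h ->
  (forall x y, f (x \ox y) = h (x \ox y)) -> f =1 h.
Proof.
move=> lf lh e t; rewrite -[t]tens_eta !lin_tens //.
by apply: eq_tens => x y; rewrite e.
Qed.

Lemma exchange_tens V W V' W' U (f : V -> W -> V' -> W' -> U) s t :
  \sw_(x, y <- s) \sw_(z, w <- t) f x y z w =
  \sw_(z, w <- t) \sw_(x, y <- s) f x y z w.
Proof.
rewrite /tens_lift; under eq_bigr => i _.
  under eq_bigr => j _ do (rewrite scaler_sumr; under eq_bigr => l _ do rewrite scaler_sumr).
  rewrite exchange_big; under eq_bigr => l _ do rewrite exchange_big; over.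
rewrite exchange_big; apply: eq_bigr => l _; rewrite exchange_big.
rewrite [RHS](_ : _ = \sum_m \sum_i \sum_j (s : 'M__) i j *: ((t : 'M__) l m *:
  f (vbasis fullv)`_i (vbasis fullv)`_j (vbasis fullv)`_l (vbasis fullv)`_m)).
  by rewrite exchange_big; apply: eq_bigr => m _; apply: eq_bigr => i _.
apply: eq_bigr => m _; rewrite scaler_sumr; apply: eq_bigr => i _.
by rewrite scaler_sumr; apply: eq_bigr => j _; rewrite !scalerA mulrC.
Qed.
End LinTheory.

(* [lin] proves linearity of composite expressions. *)
Ltac lin_step :=
  lazymatch goal with
  | |- bilin _ => split
  | |- forall _, _ => intro
  | |- lin _ =>
    first
    [ exact: lin_id | exact: lin_lfun0 | assumption
    | apply: lin_swb | apply: lin_swa | apply: lin_scalel | apply: lin_scaler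
    | apply: lin_oxl | apply: lin_oxr
    | apply: lin_mull | apply: lin_mulr | apply: lin_kmull | apply: lin_kmulr
    | apply: lin_linfun
    | apply: lin_lfun | apply: lin_lfunl | apply: lin_duall ]
  end.

Ltac lin := repeat lin_step.

Section DualVect.
Variable k : fieldType.

Definition dual_basis (V : vectType k) (i : 'I_(\dim {:V})) : dual V :=
  linfun (coord (vbasis {:V}) i : V -> k^o).

Lemma dual_basisE (V : vectType k) (f : dual V) :
  f = \sum_(i < \dim {:V}) (f (vbasis {:V})`_i : k) *: dual_basis i.
Proof.
apply/lfunP => x; rewrite {1}(coord_vbasis (memvf x)) linear_sum sum_lfunE.
by apply: eq_bigr => i _; rewrite linearZ /= scale_lfunE lfunE /= /GRing.scale /= mulrC.
Qed.

Lemma dual_sep_l (V W : vectType k) (s t : tens (dual V) W) :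
  (forall v, \sw_(f, w <- s) ((f v : k) *: w) = \sw_(f, w <- t) ((f v : k) *: w)) -> s = t.
Proof.
suff E u : u = \sum_(i < \dim {:V})
    dual_basis i \ox \sw_(f, w <- u) ((f (vbasis {:V})`_i : k) *: w) :> tens (dual V) W.
  by move=> e; rewrite (E s) (E t); apply: eq_bigr => i _; rewrite e.

rewrite -[LHS]tens_eta.
transitivity (\sw_(f, w <- u) (\sum_(i < \dim {:V})
    dual_basis i \ox ((f (vbasis {:V})`_i : k) *: w))).
  apply: eq_tens => f w; rewrite {1}[f]dual_basisE.
  rewrite (lin_sum (f := fun f : dual V => f \ox w)); lin.
  apply: eq_bigr => i _; rewrite (linZ (f := fun f : dual V => f \ox w)); lin.
  by rewrite (linZ (f := fun w => dual_basis i \ox w)); lin.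
rewrite tens_big; apply: eq_bigr => i _.
by rewrite (lin_tens (f := fun w => dual_basis i \ox w)); lin.
Qed.

Lemma dual_sep2 (V W : vectType k) (s t : tens (dual V) (dual W)) :
  (forall v w, \sw_(f, g <- s) (f v * g w : k^o)
             = \sw_(f, g <- t) (f v * g w : k^o)) -> s = t.
Proof.
move=> e; apply: dual_sep_l => v; apply/lfunP => w.
rewrite !(lin_tens (f := fun g : dual W => (g w : k^o))); lin.
rewrite -[LHS](eq_tens (f := fun f g => ((f : dual V) v * (g : dual W) w : k^o))).
  rewrite e; apply: eq_tens => f g; by rewrite scale_lfunE.
by move=> f g; rewrite scale_lfunE.
Qed.

Definition ev (V : vectType k) (v : V) : dual (dual V) :=
  linfun (fun f : dual V => f v : k^o).

Lemma evE (V : vectType k) (v : V) (f : dual V) : ev v f = f v.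
Proof. by rewrite linE //; lin. Qed.
End DualVect.

HB.mixin Record Falgebra_isHopf (k : fieldType) H of Falgebra k H := {
  comul : 'Hom(H, tens H H);
  counit : dual H;
  antipode : 'End(H);
  comulA : forall h : H,
    \sw_(x, y <- comul h) \sw_(z, w <- comul x) (z \ox (w \ox y))
    = \sw_(x, y <- comul h) (x \ox comul y);
  counitl : forall h : H, \sw_(x, y <- comul h) ((counit x : k) *: y) = h;
  counitr : forall h : H, \sw_(x, y <- comul h) ((counit y : k) *: x) = h;
  comul1 : comul 1 = 1 \ox 1;
  comulM : forall a b : H,
    comul (a * b) =
      \sw_(x, y <- comul a) \sw_(z, w <- comul b) ((x * z) \ox (y * w));
  counit1 : counit 1 = 1;
  counitM : forall a b : H, counit (a * b) = counit a * counit b;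
  antipodel : forall h : H,
    \sw_(x, y <- comul h) (antipode x * y) = (counit h : k) *: 1;
  antipoder : forall h : H,
    \sw_(x, y <- comul h) (x * antipode y) = (counit h : k) *: 1
}.
#[short(type="hopfType")]
HB.structure Definition Hopf (k : fieldType) :=
  { H of Falgebra_isHopf k H & Falgebra k H }.

Section HopfTheory.
Variables (k : fieldType) (H : hopfType k).
Implicit Types (U : vectType k) (x y h : H).

Lemma comulAE U (f : H -> H -> H -> U) h :
  (forall y z, lin (fun x => f x y z)) -> (forall x z, lin (fun y => f x y z)) ->
  (forall x y, lin (f x y)) ->
  \sw_(x, y <- comul h) \sw_(z, w <- comul x) f z w y =
  \sw_(x, y <- comul h) \sw_(z, w <- comul y) f x z w.
Proof.
move=> l1 l2 l3.
have b1 x : bilin (f x) by split.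
pose F x (t : tens H H) := \sw_(z, w <- t) f x z w.
have b2 : bilin F by split=> [t|x]; lin; apply: l1.
have e := congr1 (fun t => tens_lift t F) (comulA h); rewrite !tens_tens in e.
etransitivity; last (etransitivity; first exact: e); apply: eq_tens => x y.
  rewrite tens_tens; apply: eq_tens => z w.
  by rewrite tens_liftE // /F tens_liftE.
by rewrite tens_liftE.
Qed.
End HopfTheory.

Section Dual.
Variables (k : fieldType) (H : hopfType k).
Implicit Types (f g : dual H) (x y h : H).

Definition dual_one : dual H := counit.
Definition dual_mul f g : dual H :=
  linfun (fun h => \sw_(x, y <- comul h) (f x * g y : k^o)).

Lemma dual_mulE f g h : dual_mul f g h = \sw_(x, y <- comul h) (f x * g y : k^o).
Proof. by rewrite linE //; lin. Qed.

Fact dual_mulA : associative dual_mul.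
Proof.
move=> f g e; apply/lfunP => h; rewrite !dual_mulE.
rewrite -[RHS](eq_tens (f := fun x y => \sw_(z, w <- comul x) (f z * g w * e y : k^o))); last first.
  move=> x y; rewrite dual_mulE.
  by rewrite -(lin_tens (f := fun u : k^o => (u * e y : k^o))) //; lin.
rewrite comulAE; lin; apply: eq_tens => x y; rewrite dual_mulE.
rewrite (lin_tens (f := fun u : k^o => (f x * u : k^o))); lin.
by apply: eq_tens => z w; rewrite mulrA.
Qed.

Fact dual_mul1r : left_id dual_one dual_mul.
Proof.
move=> f; apply/lfunP => h; rewrite dual_mulE -[h in RHS]counitl.
rewrite (lin_tens (f := f : 'Hom(_, _))); lin.
by apply: eq_tens => x y; rewrite linearZ.
Qed.

Fact dual_mulr1 : right_id dual_one dual_mul.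
Proof.
move=> f; apply/lfunP => h; rewrite dual_mulE -[h in RHS]counitr.
rewrite (lin_tens (f := f : 'Hom(_, _))); lin.
by apply: eq_tens => x y; rewrite linearZ /GRing.scale /= mulrC.
Qed.

Fact dual_lin_l g : lin (fun f => dual_mul f g).
Proof. by rewrite /dual_mul; lin. Qed.
Fact dual_lin_r f : lin (dual_mul f).
Proof. by rewrite /dual_mul; lin. Qed.

Fact dual_mulDl : left_distributive dual_mul +%R.
Proof. by move=> f g e; have := dual_lin_l e 1 f g; rewrite !scale1r. Qed.
Fact dual_mulDr : right_distributive dual_mul +%R.
Proof. by move=> f g e; have := dual_lin_r f 1 g e; rewrite !scale1r. Qed.

Fact dual_one_neq0 : dual_one != 0.
Proof.
apply/eqP => /lfunP/(_ 1); rewrite zero_lfunE counit1 => /eqP.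
by rewrite oner_eq0.
Qed.

Fact dual_scalerAl a f g : a *: dual_mul f g = dual_mul (a *: f) g.
Proof. by rewrite (linZ _ _ (dual_lin_l g)). Qed.
Fact dual_scalerAr a f g : a *: dual_mul f g = dual_mul f (a *: g).
Proof. by rewrite (linZ _ _ (dual_lin_r f)). Qed.
End Dual.

Section DualInst.
Variables (k : fieldType) (H : hopfType k).
HB.instance Definition _ := GRing.Zmodule_isNzRing.Build (dual H)
  (@dual_mulA k H) (@dual_mul1r k H) (@dual_mulr1 k H)
  (@dual_mulDl k H) (@dual_mulDr k H) (@dual_one_neq0 k H).
HB.instance Definition _ := GRing.Lmodule_isLalgebra.Build k (dual H)
  (@dual_scalerAl k H).
HB.instance Definition _ := GRing.Lalgebra_isAlgebra.Build k (dual H)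
  (@dual_scalerAr k H).
HB.instance Definition _ := Algebra_isFalgebra.Build k (dual H).
End DualInst.

Section DualHopf.
Variables (k : fieldType) (H : hopfType k).
Implicit Types (f g : dual H) (x y h : H).

Lemma dualME f g h : (f * g) h = \sw_(x, y <- comul h) (f x * g y : k^o).
Proof. exact: dual_mulE. Qed.
Lemma dual1E h : (1 : dual H) h = counit h. Proof. by []. Qed.

Definition dual_comul : 'Hom(dual H, tens (dual H) (dual H)) :=
  linfun (fun f => \sum_(i < \dim {:H}) \sum_(j < \dim {:H})
    (f ((vbasis {:H})`_i * (vbasis {:H})`_j) : k) *: (dual_basis i \ox dual_basis j)).

Lemma dual_comulE f x y :
  \sw_(a, b <- dual_comul f) (a x * b y : k^o) = f (x * y).
Proof.

have F : lin (fun f : dual H => \sum_(i < \dim {:H}) \sum_(j < \dim {:H})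
    (f ((vbasis {:H})`_i * (vbasis {:H})`_j) : k) *: (dual_basis i \ox dual_basis j)).
  apply: lin_big => i _; apply: lin_big => j _; lin.
rewrite linE //.
set E := fun t : tens (dual H) (dual H) => \sw_(a, b <- t) (a x * b y : k^o).
have lE : lin E by rewrite /E; lin.
rewrite -[LHS]/(E _) lin_sum //.
rewrite [in RHS](coord_vbasis (memvf x)) mulr_suml linear_sum; apply: eq_bigr => i _.
rewrite lin_sum // [in RHS](coord_vbasis (memvf y)) mulr_sumr linear_sum.
apply: eq_bigr => j _; rewrite linZ // /E tens_liftE; last by lin.
rewrite -scalerAl -scalerAr !linearZ /= !lfunE /= /GRing.scale /=.
by congr (_ * _); apply: mulrC.
Qed.

Definition dual_counit : dual (dual H) := ev (1 : H).
Definition dual_antipode : 'End(dual H) :=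
  linfun (fun f : dual H => (f \o antipode)%VF : dual H).

Lemma dual_counitE f : dual_counit f = f 1.
Proof. exact: evE. Qed.
Lemma dual_antipodeE f x : dual_antipode f x = f (antipode x).
Proof.
rewrite linE ?comp_lfunE // => a u v; apply/lfunP => y.
by rewrite !lfunE /= !lfunE /= !lfunE.
Qed.

Fact dual_comulA f :
    \sw_(x, y <- dual_comul f) \sw_(z, w <- dual_comul x) (z \ox (w \ox y))
    = \sw_(x, y <- dual_comul f) (x \ox dual_comul y).
Proof.
apply: dual_sep_l => x; apply: dual_sep2 => y z.
set E := fun t : tens (dual H) (tens (dual H) (dual H)) =>
  \sw_(a, b <- \sw_(c, d <- t) ((c x : k) *: d))
    ((a : dual H) y * (b : dual H) z : k^o).
have lE : lin E by rewrite /E; lin.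
rewrite -[LHS]/(E _) -[RHS]/(E _) !lin_tens //.
transitivity (f (x * y * z)).
  rewrite -dual_comulE; apply: eq_tens => a b.
  rewrite lin_tens // -dual_comulE.
  rewrite (lin_tens (f := fun u : k^o => u * (b : dual H) z : k^o)); lin.
  apply: eq_tens => c d; rewrite /E tens_liftE; lin.
  by rewrite (linZ _ _ (tens_lift_lin _)) tens_liftE; lin; rewrite /GRing.scale /= mulrA.
rewrite -mulrA -dual_comulE; apply: eq_tens => a b; rewrite /E tens_liftE; lin.
by rewrite (linZ _ _ (tens_lift_lin _)) dual_comulE.
Qed.

Fact dual_counitl f : \sw_(x, y <- dual_comul f) ((dual_counit x : k) *: y) = f.
Proof.
apply/lfunP => y; rewrite (lin_tens (f := fun g : dual H => g y : k^o)); lin.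
rewrite -[y in RHS]mul1r -dual_comulE; apply: eq_tens => a b.
by rewrite scale_lfunE dual_counitE.
Qed.

Fact dual_counitr f : \sw_(x, y <- dual_comul f) ((dual_counit y : k) *: x) = f.
Proof.
apply/lfunP => y; rewrite (lin_tens (f := fun g : dual H => g y : k^o)); lin.
rewrite -[y in RHS]mulr1 -dual_comulE; apply: eq_tens => a b.
by rewrite scale_lfunE dual_counitE mulrC.
Qed.

Fact dual_comul1 : dual_comul 1 = 1 \ox 1.
Proof.
apply: dual_sep2 => x y; rewrite dual_comulE tens_liftE; lin.
by rewrite !dual1E counitM.
Qed.

Fact dual_comulM f g : dual_comul (f * g) =
  \sw_(x, y <- dual_comul f) \sw_(z, w <- dual_comul g) ((x * z) \ox (y * w)).
Proof.
apply: dual_sep2 => x y; rewrite dual_comulE dualME comulM.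
set E := fun t : tens (dual H) (dual H) => \sw_(a, b <- t) (a x * b y : k^o).
have lE : lin E by rewrite /E; lin.
rewrite -[RHS]/(E _) !lin_tens //.
pose P (a b c d : dual H) : k^o :=
  \sw_(x1, x2 <- comul x) \sw_(y1, y2 <- comul y) (a x1 * b y1 * (c x2 * d y2) : k^o).
transitivity (\sw_(a, b <- dual_comul f) \sw_(c, d <- dual_comul g) P a b c d).
  rewrite /P tens_tens.
  under [RHS]eq_tens => a b do rewrite exchange_tens.
  rewrite exchange_tens; apply: eq_tens => x1 x2.
  under [RHS]eq_tens => a b do rewrite exchange_tens.
  rewrite tens_tens exchange_tens; apply: eq_tens => y1 y2.
  rewrite tens_liftE; lin.
  rewrite -!dual_comulE (lin_tens (f := fun u : k^o => u * _ : k^o)); lin.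
  apply: eq_tens => a b.
  by rewrite (lin_tens (f := fun u : k^o => _ * u : k^o)); lin.
apply: eq_tens => a b; rewrite lin_tens //; apply: eq_tens => c d.
rewrite /E tens_liftE; lin; rewrite !dualME /P.
rewrite (lin_tens (f := fun u : k^o => u * _ : k^o)); lin; apply: eq_tens => x1 x2.
rewrite (lin_tens (f := fun u : k^o => _ * u : k^o)); lin; apply: eq_tens => y1 y2.
by rewrite mulrACA.
Qed.

Fact dual_counit1 : dual_counit 1 = 1.
Proof. by rewrite dual_counitE dual1E counit1. Qed.

Fact dual_counitM f g : dual_counit (f * g) = dual_counit f * dual_counit g.
Proof. by rewrite !dual_counitE dualME comul1 tens_liftE; lin. Qed.

Fact dual_antipodel f :
  \sw_(x, y <- dual_comul f) (dual_antipode x * y) = (dual_counit f : k) *: 1.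
Proof.
apply/lfunP => h; rewrite (lin_tens (f := fun g : dual H => g h : k^o)); lin.
under eq_tens => a b do rewrite dualME.
rewrite exchange_tens scale_lfunE dual1E dual_counitE.
transitivity (f ((counit h : k) *: 1)); last by rewrite linearZ /GRing.scale /= mulrC.
rewrite -antipodel (lin_tens (f := f : 'Hom(_, _))); lin.
apply: eq_tens => x y; rewrite -dual_comulE; apply: eq_tens => a b.
by rewrite dual_antipodeE.
Qed.

Fact dual_antipoder f :
  \sw_(x, y <- dual_comul f) (x * dual_antipode y) = (dual_counit f : k) *: 1.
Proof.
apply/lfunP => h; rewrite (lin_tens (f := fun g : dual H => g h : k^o)); lin.
under eq_tens => a b do rewrite dualME.
rewrite exchange_tens scale_lfunE dual1E dual_counitE.
transitivity (f ((counit h : k) *: 1)); last by rewrite linearZ /GRing.scale /= mulrC.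
rewrite -antipoder (lin_tens (f := f : 'Hom(_, _))); lin.
apply: eq_tens => x y; rewrite -dual_comulE; apply: eq_tens => a b.
by rewrite dual_antipodeE.
Qed.
End DualHopf.

HB.instance Definition _ (k : fieldType) (H : hopfType k) :=
  Falgebra_isHopf.Build k (dual H) (@dual_comulA k H)
    (@dual_counitl k H) (@dual_counitr k H) (@dual_comul1 k H) (@dual_comulM k H)
    (@dual_counit1 k H) (@dual_counitM k H)
    (@dual_antipodel k H) (@dual_antipoder k H).


Section DualHopfTheory.
Variables (k : fieldType) (H : hopfType k).
Implicit Types (f : dual H) (x y : H).

Lemma counit_dualE f : counit f = f 1.
Proof. exact: dual_counitE. Qed.
Lemma antipode_dualE f x : (antipode f : dual H) x = f (antipode x).
Proof. exact: dual_antipodeE. Qed.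
Lemma comul_dualE f x y :
  \sw_(a, b <- comul f) (a x * b y : k^o) = f (x * y).
Proof. exact: dual_comulE. Qed.
End DualHopfTheory.

Reserved Notation "a ** b" (at level 40, left associativity).

(* The algebra structures of the library are nontrivial rings (1 != 0); this
   one also allows the zero algebra. *)
HB.mixin Record Vector_isUnitalAlgebra (k : fieldType) B of Vector k B := {
  uone : B;
  umul : B -> B -> B;
  umulA : associative umul;
  umul1b : left_id uone umul;
  umulb1 : right_id uone umul;
  umul_linearl : forall b : B, linear (umul^~ b);
  umul_linearr : forall b : B, linear (umul b)
}.
#[short(type="ualgType")]
HB.structure Definition UnitalAlgebra (k : fieldType) :=
  { B of Vector_isUnitalAlgebra k B & Vector k B }.

Notation "a ** b" := (umul a b) : ring_scope.

HB.mixin Record isComoduleAlgebra (k : fieldType) (L : hopfType k) B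
    of UnitalAlgebra k B := {
  coact : 'Hom(B, tens B L);
  coactA : forall b : B,
    \sw_(c, l <- coact b) \sw_(c0, c1 <- coact c) (c0 \ox (c1 \ox l))
    = \sw_(c, l <- coact b) (c \ox comul l);
  coact_counit : forall b : B, \sw_(c, l <- coact b) ((counit l : k) *: c) = b;
  coact1 : coact uone = uone \ox 1;
  coactM : forall a b : B,
    coact (a ** b) =
      \sw_(a0, a1 <- coact a) \sw_(b0, b1 <- coact b) ((a0 ** b0) \ox (a1 * b1))
}.
#[short(type="comodAlgType")]
HB.structure Definition ComoduleAlgebra (k : fieldType) (L : hopfType k) :=
  { B of isComoduleAlgebra k L B & UnitalAlgebra k B }.

Lemma lin_umull (k : fieldType) (U : vectType k) (B : ualgType k) (e : U -> B) b :
  lin e -> lin (fun x => e x ** b).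
Proof. by move=> le a x y; rewrite le umul_linearl. Qed.
Lemma lin_umulr (k : fieldType) (U : vectType k) (B : ualgType k) (e : U -> B) b :
  lin e -> lin (fun x => b ** e x).
Proof. by move=> le a x y; rewrite le umul_linearr. Qed.

Section Action.
Variables (k : fieldType) (L : hopfType k) (B : comodAlgType L).

Definition hact (f : dual L) (b : B) : B :=
  \sw_(b0, b1 <- coact b) ((f b1 : k) *: b0).

Lemma lin_hactl (U : vectType k) (e : U -> dual L) b :
  lin e -> lin (fun x => hact (e x) b).
Proof. by rewrite /hact; lin. Qed.
Lemma lin_hactr (U : vectType k) (e : U -> B) f :
  lin e -> lin (fun x => hact f (e x)).
Proof. by rewrite /hact; lin. Qed.
End Action.

Ltac lin_step ::=
  lazymatch goal with
  | |- bilin _ => split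
  | |- forall _, _ => intro
  | |- lin _ =>
    first
    [ exact: lin_id | exact: lin_lfun0 | assumption
    | apply: lin_swb | apply: lin_swa | apply: lin_scalel | apply: lin_scaler
    | apply: lin_oxl | apply: lin_oxr
    | apply: lin_umull | apply: lin_umulr | apply: lin_hactl | apply: lin_hactr
    | apply: lin_mull | apply: lin_mulr | apply: lin_kmull | apply: lin_kmulr
    | apply: lin_linfun
    | apply: lin_lfun | apply: lin_lfunl | apply: lin_duall ]
  end.

Section ActionTheory.
Variables (k : fieldType) (L : hopfType k) (B : comodAlgType L).
Implicit Types (a b c : B) (f g : dual L).

Lemma coactAE (U : vectType k) (f : B -> L -> L -> U) b :
  (forall y z, lin (fun x => f x y z)) -> (forall x z, lin (fun y => f x y z)) ->
  (forall x y, lin (f x y)) ->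
  \sw_(x, y <- coact b) \sw_(z, w <- coact x) f z w y =
  \sw_(x, y <- coact b) \sw_(z, w <- comul y) f x z w.
Proof.
move=> l1 l2 l3.
have b1 x : bilin (f x) by split.
pose F x (t : tens L L) := \sw_(z, w <- t) f x z w.
have b2 : bilin F by split=> [t|x]; lin; apply: l1.
have e := congr1 (fun t => tens_lift t F) (coactA b); rewrite !tens_tens in e.
etransitivity; last (etransitivity; first exact: e); apply: eq_tens => x y.
  rewrite tens_tens; apply: eq_tens => z w.
  by rewrite tens_liftE // /F tens_liftE.
by rewrite tens_liftE.
Qed.

Lemma hact1 b : hact 1 b = b.
Proof. exact: coact_counit. Qed.

Lemma hactM f g b : hact (f * g) b = hact f (hact g b).
Proof.
rewrite /hact (lin_tens (f := coact : 'Hom(_, _))); lin; rewrite tens_tens.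
transitivity (\sw_(x, y <- coact b) \sw_(z, w <- comul y) ((f z * g w : k) *: x)).
  apply: eq_tens => x y; rewrite dualME.
  by rewrite (lin_tens (f := fun u : k^o => (u : k) *: x)); lin.
rewrite -coactAE; lin; apply: eq_tens => x y.
rewrite linearZ /= (linZ _ _ (tens_lift_lin _)).
rewrite (lin_tens (f := fun u : B => (g y : k) *: u)); lin; apply: eq_tens => z w.
by rewrite scalerA mulrC.
Qed.

Lemma hact_one f : hact f (uone : B) = (f 1 : k) *: uone.
Proof. by rewrite /hact coact1 tens_liftE; lin. Qed.

Lemma hact_mul f a b :
  hact f (a ** b) = \sw_(f1, f2 <- comul f) (hact f1 a ** hact f2 b).
Proof.
rewrite /hact coactM tens_tens.
transitivity (\sw_(x, y <- coact a) \sw_(z, w <- coact b) ((f (y * w) : k) *: (x ** z))).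
  by apply: eq_tens => x y; rewrite tens_tens; apply: eq_tens => z w; rewrite tens_liftE; lin.
transitivity (\sw_(x, y <- coact a) \sw_(z, w <- coact b) \sw_(f1, f2 <- comul f)
   (((f1 y : k) *: x) ** ((f2 w : k) *: z))).
  apply: eq_tens => x y; apply: eq_tens => z w.
  rewrite -dual_comulE (lin_tens (f := fun u : k^o => (u : k) *: (x ** z))); lin.
  apply: eq_tens => f1 f2.
  rewrite (linZ (f := fun u => u ** _)); lin.
  by rewrite (linZ (f := fun u => _ ** u)); lin; rewrite scalerA.
under eq_tens => x y do rewrite exchange_tens.
rewrite exchange_tens; apply: eq_tens => f1 f2.
rewrite (lin_tens (f := fun u => u ** _)); lin; apply: eq_tens => x y.
by rewrite (lin_tens (f := fun u => _ ** u)); lin.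
Qed.
End ActionTheory.

Definition smash (k : fieldType) (H : hopfType k) (A : comodAlgType H) : Type :=
  tens A (dual H).
HB.instance Definition _ k H A := Vector.on (@smash k H A).

Section Smash.
Variables (k : fieldType) (H : hopfType k) (A : comodAlgType H).
Implicit Types (a b c : A) (f g h : dual H) (s t u : smash A).

Definition smash_one : smash A := (uone : A) \ox (1 : dual H).

Definition smash_mul s t : smash A :=
  \sw_(a, f <- s) \sw_(b, g <- t) \sw_(f1, f2 <- comul f)
    ((a ** hact f1 b) \ox (f2 * g)).

Definition smash_coact : 'Hom(smash A, tens (smash A) (dual H)) :=
  linfun (fun s : smash A => \sw_(a, f <- s) \sw_(f1, f2 <- comul f)
    ((a \ox f1 : smash A) \ox f2)).

Lemma smash_mul_linl t : lin (smash_mul^~ t).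
Proof. by rewrite /smash_mul; apply: lin_swa; lin. Qed.
Lemma smash_mul_linr s : lin (smash_mul s).
Proof. by rewrite /smash_mul; lin. Qed.

Lemma smash_mulE a f b g : smash_mul (a \ox f) (b \ox g) =
  \sw_(f1, f2 <- comul f) ((a ** hact f1 b) \ox (f2 * g)).
Proof. by rewrite /smash_mul tens_liftE ?tens_liftE; lin. Qed.

Fact smash_mulA : associative smash_mul.
Proof.
move=> s t u.
apply: (lin_ext (f := fun s => smash_mul s (smash_mul t u))
  (h := fun s => smash_mul (smash_mul s t) u)) => [||a f].
- exact: smash_mul_linl.
- by move=> x y z; rewrite !smash_mul_linl.
apply: (lin_ext (f := fun t => smash_mul (a \ox f) (smash_mul t u))
  (h := fun t => smash_mul (smash_mul (a \ox f) t) u)) => [||b g].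
- by move=> x y z; rewrite smash_mul_linl smash_mul_linr.
- by move=> x y z; rewrite smash_mul_linr smash_mul_linl.
apply: (lin_ext (f := fun u => smash_mul (a \ox f) (smash_mul (b \ox g) u))
  (h := fun u => smash_mul (smash_mul (a \ox f) (b \ox g)) u)) => [||c h].
- by move=> x y z; rewrite !smash_mul_linr.
- exact: smash_mul_linr.
rewrite !smash_mulE (lin_tens _ _ (smash_mul_linr _)).
rewrite (lin_tens _ _ (smash_mul_linl _)).
under eq_tens => g1 g2 do rewrite smash_mulE.
under [RHS]eq_tens => f1 f2 do rewrite smash_mulE comulM tens_tens.
transitivity (\sw_(g1, g2 <- comul g) \sw_(f1, f2 <- comul f)
    \sw_(p, q <- comul f1)
      ((a ** (hact p b ** hact (q * g1) c)) \ox (f2 * (g2 * h)))).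
  apply: eq_tens => g1 g2; apply: eq_tens => f1 f2; rewrite hact_mul.
  rewrite (lin_tens (f := fun z => (a ** z) \ox _)); lin.
  by apply: eq_tens => p q; rewrite hactM.
rewrite exchange_tens.
under eq_tens => x y do rewrite exchange_tens.
rewrite (comulAE (f := fun p q r => \sw_(z, w <- comul g)
  ((a ** (hact p b ** hact (q * z) c)) \ox (r * (w * h))))); lin.
apply: eq_tens => p r; apply: eq_tens => q f2; rewrite tens_tens.
by apply: eq_tens => z w; rewrite tens_liftE; lin; rewrite umulA mulrA.
Qed.

Fact smash_mul1s : left_id smash_one smash_mul.
Proof.
apply: (lin_ext (f := smash_mul smash_one) (h := fun z => z)) => [||b g].
- exact: smash_mul_linr.
- by [].
rewrite smash_mulE comul1 tens_liftE; lin.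
by rewrite hact1 umul1b mul1r.
Qed.

Fact smash_muls1 : right_id smash_one smash_mul.
Proof.
apply: (lin_ext (f := smash_mul^~ smash_one) (h := fun z => z)) => [||a f].
- exact: smash_mul_linl.
- by [].
rewrite smash_mulE -[f in RHS]counitl.
rewrite (lin_tens (f := fun z => a \ox z)); lin; apply: eq_tens => x y.
rewrite hact_one (linZ (f := fun z => (a ** z) \ox _)); lin.
by rewrite umulb1 mulr1 counit_dualE (linZ (f := fun z => a \ox z)); lin.
Qed.

HB.instance Definition _ := Vector_isUnitalAlgebra.Build k (smash A)
  smash_mulA smash_mul1s smash_muls1 smash_mul_linl smash_mul_linr.

Lemma smash_coactE a f : smash_coact (a \ox f) =
  \sw_(f1, f2 <- comul f) ((a \ox f1 : smash A) \ox f2).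
Proof. by rewrite linE ?tens_liftE; lin. Qed.

Fact smash_coactA s :
    \sw_(c, l <- smash_coact s) \sw_(c0, c1 <- smash_coact c) (c0 \ox (c1 \ox l))
    = \sw_(c, l <- smash_coact s) (c \ox comul l).
Proof.
apply: (lin_ext
  (f := fun s => \sw_(c, l <- smash_coact s)
     \sw_(c0, c1 <- smash_coact c) (c0 \ox (c1 \ox l)))
  (h := fun s => \sw_(c, l <- smash_coact s) (c \ox comul l))) => [||a f]; lin.
rewrite smash_coactE !tens_tens.
transitivity (\sw_(x, y <- comul f) \sw_(z, w <- comul x)
   ((a \ox z : smash A) \ox (w \ox y))).
  apply: eq_tens => x y; rewrite tens_liftE; lin.
  by rewrite smash_coactE tens_tens; apply: eq_tens => z w; rewrite tens_liftE; lin.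
rewrite (comulAE (f := fun z w y => (a \ox z : smash A) \ox (w \ox y))); lin.
apply: eq_tens => x y; rewrite tens_liftE; lin.
rewrite -[comul y]tens_eta (lin_tens (f := fun z => (a \ox x : smash A) \ox z)); lin.
by rewrite tens_eta.
Qed.

Fact smash_coact_counit s :
  \sw_(c, l <- smash_coact s) ((counit l : k) *: c) = s.
Proof.
apply: (lin_ext
  (f := fun s => \sw_(c, l <- smash_coact s) ((counit l : k) *: c))
  (h := fun s : smash A => s)) => [||a f]; lin.
rewrite smash_coactE tens_tens -[f in RHS]counitr.
rewrite (lin_tens (f := fun z => a \ox z)); lin; apply: eq_tens => x y.
by rewrite tens_liftE; lin; rewrite (linZ (f := fun z => a \ox z)); lin.
Qed.

Fact smash_coact1 : smash_coact smash_one = smash_one \ox 1.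
Proof. by rewrite smash_coactE comul1 tens_liftE; lin. Qed.

Fact smash_coactM s t : smash_coact (smash_mul s t) =
  \sw_(a0, a1 <- smash_coact s) \sw_(b0, b1 <- smash_coact t)
    (smash_mul a0 b0 \ox (a1 * b1)).
Proof.
have ml (U : vectType k) (e : U -> smash A) x : lin e -> lin (fun y => smash_mul (e y) x).
  by move=> le p q r; rewrite le smash_mul_linl.
have mr (U : vectType k) (e : U -> smash A) x : lin e -> lin (fun y => smash_mul x (e y)).
  by move=> le p q r; rewrite le smash_mul_linr.
pose F s t := \sw_(a0, a1 <- smash_coact s) \sw_(b0, b1 <- smash_coact t)
    ((smash_mul a0 b0 : smash A) \ox (a1 * b1)).
rewrite -[RHS]/(F s t).
apply: (lin_ext (f := fun s => smash_coact (smash_mul s t)) (h := F^~ t)) => [||a f].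
- by apply: lin_lfun; apply: ml; lin.
- by rewrite /F; apply: lin_swa; lin.
apply: (lin_ext (f := fun t => smash_coact (smash_mul (a \ox f) t)) (h := F _)) => [||b g].
- by apply: lin_lfun; apply: mr; lin.
- by rewrite /F; apply: lin_swb => x y; apply: lin_swa; lin.
rewrite /F smash_mulE !smash_coactE (lin_tens (f := smash_coact : 'Hom(_, _))); lin.
transitivity (\sw_(f1, f2 <- comul f) \sw_(p, q <- comul f2) \sw_(g1, g2 <- comul g)
   (((a ** hact f1 b) \ox (p * g1) : smash A) \ox (q * g2))).
  apply: eq_tens => f1 f2; rewrite smash_coactE comulM tens_tens.
  apply: eq_tens => p q; rewrite tens_tens; apply: eq_tens => g1 g2.
  by rewrite tens_liftE; lin.
rewrite -(comulAE (f := fun f1 p q => \sw_(g1, g2 <- comul g)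
   (((a ** hact f1 b) \ox (p * g1) : smash A) \ox (q * g2)))); lin.
rewrite tens_tens; apply: eq_tens => x y.
rewrite tens_liftE; last first.
  split=> z; first by apply: lin_swb => u v; apply: lin_oxl; apply: ml; lin.
  by lin.
rewrite tens_tens exchange_tens; apply: eq_tens => g1 g2.
rewrite tens_liftE; last first.
  split=> z; first by apply: lin_oxl; apply: mr; lin.
  by lin.
rewrite smash_mulE.
by rewrite (lin_tens (f := fun z : smash A => z \ox (y * g2))); lin.
Qed.

HB.instance Definition _ := isComoduleAlgebra.Build k (dual H) (smash A)
  smash_coactA smash_coact_counit smash_coact1 smash_coactM.
End Smash.

Section Symmetric.
Variables (k : fieldType) (L : hopfType k).

Definition is_character (u : dual L) : Prop :=
  u 1 = 1 /\ forall x y : L, u (x * y) = u x * u y.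

Section DualBimodule.
Variables (u : dual L) (B : comodAlgType L).
Implicit Types (b c : B) (f : dual B).

(* The bimodule and comodule structure of F(dual B), which lies in the category
   of B,B-bimodules in right L-comodules when [u] is a sovereign character of
   [L]. The coaction is the one determined by [dual_coactP], and the left action
   uses u^-1 = u \o antipode. *)
Definition dual_coact f : tens (dual B) L :=
  \sum_(i < \dim {:B}) dual_basis i \ox
    \sw_(b0, b1 <- coact (vbasis {:B})`_i) ((f b0 : k) *: antipode b1).

Definition dual_ract f b : dual B := linfun (fun c => f (b ** c) : k^o).

Definition dual_lact b f : dual B :=
  linfun (fun c => f (c ** hact (u \o antipode)%VF b) : k^o).

Lemma dual_coactP f b :
  \sw_(f0, f1 <- dual_coact f) ((f0 b : k) *: f1)
  = \sw_(b0, b1 <- coact b) ((f b0 : k) *: antipode b1).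
Proof.
rewrite (lin_sum (f := fun t : tens (dual B) L => \sw_(f0, f1 <- t) ((f0 b : k) *: f1))); lin.
pose F b := \sw_(b0, b1 <- coact b) ((f b0 : k) *: antipode b1).
have lF : lin F by rewrite /F; lin.
rewrite -[RHS]/(F b) [in RHS](coord_vbasis (memvf b)) lin_sum //.
apply: eq_bigr => i _; rewrite linZ // tens_liftE; lin.
by rewrite lfunE.
Qed.

Lemma dual_coact_uniq f (t : tens (dual B) L) :
  (forall b, \sw_(f0, f1 <- t) ((f0 b : k) *: f1)
             = \sw_(b0, b1 <- coact b) ((f b0 : k) *: antipode b1)) ->
  t = dual_coact f.
Proof. by move=> e; apply: dual_sep_l => b; rewrite e dual_coactP. Qed.

Lemma dual_ractE f b c : dual_ract f b c = f (b ** c).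
Proof. by rewrite linE //; lin. Qed.

Lemma dual_lactE b f c :
  dual_lact b f c = f (c ** hact (u \o antipode)%VF b).
Proof. by rewrite linE //; lin. Qed.
End DualBimodule.

(* An isomorphism B -> F(dual B) of B,B-bimodules in right L-comodules. *)
Definition comod_symmetric (u : dual L) (B : comodAlgType L) : Prop :=
  exists phi : 'Hom(B, dual B),
    [/\ bijective phi,
        forall b c : B, phi (b ** c) = dual_lact u b (phi c),
        forall b c : B, phi (b ** c) = dual_ract (phi b) c
      & forall b : B, dual_coact (phi b)
                      = \sw_(b0, b1 <- coact b) (phi b0 \ox b1)].
End Symmetric.

Section Distinguished.
Variables (k : fieldType) (H : hopfType k).

Definition left_integral_in (t : H) : Prop :=
  forall h : H, h * t = (counit h : k) *: t.

Definition left_integral_on (T : dual H) : Prop :=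
  forall f : dual H, f * T = (f 1 : k) *: T.

Definition is_grouplike (g : H) : Prop :=
  comul g = g \ox g /\ counit g = 1.

Definition distinguished_char (alpha : dual H) : Prop :=
  is_character alpha /\
  forall t : H, left_integral_in t -> forall h : H, t * h = (alpha h : k) *: t.

Definition distinguished_grouplike (g : H) : Prop :=
  is_grouplike g /\
  forall T : dual H, left_integral_on T ->
  forall f : dual H, T * f = (f g : k) *: T.
End Distinguished.

(* Main.v *)
(* Sending an isomorphism phi : A -> F(dual A) to lam = phi 1 identifies such
   isomorphisms with the coinvariant nondegenerate functionals lam on A that are
   symmetric up to the action of the sovereign character. Coinvariance of a
   functional on A # dual H says that it is a right integral of H in the second
   variable, so by uniqueness of integrals it has the form
   a # f |-> lam(a) f(t) with t a fixed nonzero right integral, and one compares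
   the conditions on the two sides. The twisted symmetry transfers thanks to the
   identities t_1 (x) t_2 = t_2 g^-1 (x) t_1 and h t = alpha^-1(h) t; the former is
   obtained by writing every functional as T(- h) for a left integral T on H. *)
Require Import Defs.
From HB Require Import structures.
From mathcomp Require Import all_boot all_algebra falgebra.

Set Implicit Arguments.
Unset Strict Implicit.
Unset Printing Implicit Defensive.

Import GRing.Theory.
Local Open Scope ring_scope.

(** * Linearity of Sweedler sums *)

Section TensTheory.
Variables (k : fieldType) (V W U : vectType k) (A : falgType k).

Lemma tens_scale c (t : tens V W) (F : V -> W -> U) :
  \sw_(x, y <- t) (c *: F x y) = c *: \sw_(x, y <- t) F x y.
Proof. by rewrite (lin_tens (f := fun u : U => c *: u)) //; lin. Qed.

Lemma tens_sub (t : tens V W) (F G : V -> W -> U) :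
  \sw_(x, y <- t) (F x y - G x y) = \sw_(x, y <- t) F x y - \sw_(x, y <- t) G x y.
Proof.
rewrite /tens_lift -sumrB; apply: eq_bigr => i _; rewrite -sumrB; apply: eq_bigr => j _.
by rewrite scalerBr.
Qed.

Lemma tens_mull (t : tens V W) (F : V -> W -> A) a :
  \sw_(x, y <- t) (F x y * a) = (\sw_(x, y <- t) F x y) * a.
Proof. by rewrite (lin_tens (f := fun u : A => u * a)) //; lin. Qed.

Lemma tens_mulr (t : tens V W) (F : V -> W -> A) a :
  \sw_(x, y <- t) (a * F x y) = a * \sw_(x, y <- t) F x y.
Proof. by rewrite (lin_tens (f := fun u : A => a * u)) //; lin. Qed.

Lemma tens_kmull (t : tens V W) (F : V -> W -> k^o) (a : k) :
  \sw_(x, y <- t) (F x y * a : k^o) = (\sw_(x, y <- t) F x y) * a.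
Proof. by rewrite (lin_tens (f := fun u : k^o => (u * a : k^o))) //; lin. Qed.

Lemma tens_kmulr (t : tens V W) (F : V -> W -> k^o) (a : k) :
  \sw_(x, y <- t) (a * F x y : k^o) = a * \sw_(x, y <- t) F x y.
Proof. by rewrite (lin_tens (f := fun u : k^o => (a * u : k^o))) //; lin. Qed.
End TensTheory.

(** * Dual bases and separation of vectors by functionals *)

Section DualSpace.
Variable k : fieldType.
Implicit Types V W : vectType k.

Lemma dim_dual V : dim (dual V) = dim V.
Proof. by rewrite /dim /= muln1. Qed.

Lemma lfun_inj_bij V W (f : 'Hom(V, W)) :
  dim V = dim W -> (forall v, f v = 0 -> v = 0) -> bijective f.
Proof.
move=> dVW f0; have kf : lker f == 0%VS.
  by rewrite -subv0; apply/subvP => x; rewrite memv_ker memv0 => /eqP/f0 ->.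
exists (f^-1)%VF; first exact: lker0_lfunK.
move=> w; apply: limg_lfunVK; suff -> : limg f = fullv by exact: memvf.
apply/eqP; rewrite eqEdim subvf limg_dim_eq ?(eqP kf) ?capv0 //.
by rewrite !dimvf dVW leqnn.
Qed.

Lemma dual_basis_vbasis V (i j : 'I_(\dim {:V})) :
  dual_basis i (vbasis {:V})`_j = (i == j)%:R.
Proof. by rewrite lfunE /= coord_free ?(basis_free (vbasisP _)) 1?eq_sym. Qed.

Lemma dual_ext V (v w : V) : (forall f : dual V, f v = f w) -> v = w.
Proof.
move=> e; rewrite (coord_vbasis (memvf v)) [RHS](coord_vbasis (memvf w)).
by apply: eq_bigr => i _; have := e (dual_basis i); rewrite !lfunE /= => ->.
Qed.

Lemma exists_dual_eq1 V (v : V) : v != 0 -> exists f : dual V, f v = 1.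
Proof.
move=> vn0; have [i fi|f0] := pickP (fun i => dual_basis i v != 0).
  exists (((dual_basis i v)^-1 : k) *: dual_basis i).
  by rewrite scale_lfunE /GRing.scale /= mulVf.
case/eqP: vn0; apply: dual_ext => f; rewrite linear0 [f]dual_basisE sum_lfunE.
by rewrite big1 // => i _; rewrite scale_lfunE (eqP (negbFE (f0 i))) scaler0.
Qed.

(** Expanding the second leg in the dual basis writes [s] as a sum of its contractions tensored with
    dual basis vectors. *)
Lemma dual_sep_r V W (s : tens V (dual W)) :
  (forall w, \sw_(v, f <- s) ((f w : k) *: v) = 0) -> s = 0.
Proof.
move=> s0; rewrite -[LHS]tens_eta.
transitivity (\sw_(v, f <- s) (\sum_(i < \dim {:W})
   (((f (vbasis {:W})`_i : k) *: v) \ox dual_basis i))).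
  apply: eq_tens => v f; rewrite {1}[f]dual_basisE.
  rewrite (lin_sum (f := fun f : dual W => v \ox f)); last by lin.
  apply: eq_bigr => i _; rewrite (linZ (f := fun f : dual W => v \ox f)); last by lin.
  by rewrite (linZ (f := fun v => v \ox dual_basis i)) //; lin.
rewrite tens_big big1 // => i _.
rewrite -(lin_tens (f := fun v => v \ox dual_basis i)); last by lin.
by rewrite s0; apply/matrixP => ? ?; rewrite !mxE linear0 mul0r.
Qed.
End DualSpace.

(** * Antimultiplicativity of the antipode, written S below *)

Section Antipode.
Variables (k : fieldType) (H : hopfType k).
Implicit Types a b h : H.

Lemma antipode1 : antipode (1 : H) = 1.
Proof.
have := antipodel (1 : H); rewrite comul1 tens_liftE; last by lin.
by rewrite mulr1 counit1 scale1r.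
Qed.

(** Both sides evaluate S(a_1 b_1) a_2 b_2 S(b_3): collapse b_2 S(b_3) for the left one, and S(a_1
    b_1) a_2 b_2 for the right one. *)
Lemma antipode_mull a b :
  \sw_(x, y <- comul a) (antipode (x * b) * y) = (counit a : k) *: antipode b.
Proof.
pose F b1 b2 b3 := \sw_(x, y <- comul a)
  (antipode (x * b1) * (y * b2) * antipode b3).
transitivity (\sw_(x, y <- comul b) \sw_(z, w <- comul x) F z w y).
  rewrite comulAE /F; lin.
  rewrite -[b in LHS]counitr (lin_tens (f := fun b => \sw_(x, y <- comul a)
    (antipode (x * b) * y))); lin; apply: eq_tens => b1 b2.
  rewrite exchange_tens.
  rewrite (linZ (f := fun b => \sw_(x, y <- comul a) (antipode (x * b) * y))); lin.
  rewrite -tens_scale; apply: eq_tens => x y.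
  under eq_tens => z w do rewrite -!mulrA.
  by rewrite !tens_mulr antipoder -!scalerAr mulr1.
rewrite -[b in RHS]counitl (lin_tens (f := antipode : 'Hom(_, _))); lin.
rewrite -tens_scale; apply: eq_tens => x y; rewrite linearZ /= scalerA -counitM.
rewrite -[in RHS](mul1r (antipode y)) scalerAl -antipodel comulM /F.
under [LHS]eq_tens => z w do rewrite tens_mull.
rewrite tens_mull exchange_tens tens_tens; congr (_ * _); apply: eq_tens => u v.
by rewrite tens_tens; apply: eq_tens => z w; rewrite tens_liftE; lin.
Qed.

(** Evaluates S(a_1 b) a_2 S(a_3) in two ways, the second through [antipode_mull]. *)
Lemma antipodeM a b : antipode (a * b) = antipode b * antipode a.
Proof.
transitivity (\sw_(x, y <- comul a) \sw_(z, w <- comul x)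
   (antipode (z * b) * w * antipode y)).
  rewrite (comulAE (f := fun z w y => antipode (z * b) * w * antipode y)); lin.
  rewrite -[a in LHS]counitr (lin_tens (f := fun a => antipode (a * b))); lin.
  apply: eq_tens => x y; under eq_tens => z w do rewrite -mulrA.
  by rewrite tens_mulr antipoder -scalerAr mulr1 -scalerAl linearZ.
rewrite -[a in RHS]counitl (lin_tens (f := fun a => antipode b * antipode a)); lin.
apply: eq_tens => x y.
by rewrite tens_mull antipode_mull linearZ -scalerAl -scalerAr.
Qed.
End Antipode.

(** * The inverse antipode, and translates of functionals *)

Section Integral.
Variables (k : fieldType) (H : hopfType k) (g : H).
Hypothesis g_grouplike : is_grouplike g.
Hypothesis antipode2 : forall h : H, antipode (antipode h) = g^-1 * h * g.
Implicit Types (h x y : H) (f e p : dual H).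

Lemma antipode_grouplike_mull : antipode g * g = 1.
Proof.
case: g_grouplike => cg eg; have := antipodel g; rewrite cg tens_liftE; last by lin.
by rewrite eg scale1r.
Qed.

Lemma antipode_grouplike_mulr : g * antipode g = 1.
Proof.
case: g_grouplike => cg eg; have := antipoder g; rewrite cg tens_liftE; last by lin.
by rewrite eg scale1r.
Qed.

Lemma grouplike_unit : g \is a GRing.unit.
Proof.
by apply/unitrP; exists (antipode g); rewrite antipode_grouplike_mull antipode_grouplike_mulr.
Qed.

Lemma grouplike_inv : g^-1 = antipode g.
Proof.
by rewrite -[LHS]mul1r -antipode_grouplike_mull mulrK // grouplike_unit.
Qed.

Lemma comul_grouplike_inv : comul g^-1 = g^-1 \ox g^-1.
Proof.
case: g_grouplike => cg _; have gu := grouplike_unit.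
have := congr1 (fun t => \sw_(x, y <- t) ((g^-1 * x) \ox (g^-1 * y))) (comulM g g^-1).
rewrite /= mulrV // comul1 tens_liftE ?mulr1; last by lin.
rewrite cg tens_liftE; last by lin.
move=> ->; rewrite tens_tens -[LHS]tens_eta; apply: eq_tens => x y.
by rewrite tens_liftE ?mulKr //; lin.
Qed.

(** Here S^2 is conjugation by a grouplike element, which is a coalgebra map. *)
Lemma comul_antipode2 h : comul (antipode (antipode h)) =
  \sw_(x, y <- comul h) (antipode (antipode x) \ox antipode (antipode y)).
Proof.
case: g_grouplike => cg _.
rewrite antipode2 comulM cg comulM comul_grouplike_inv tens_liftE; last by lin.
rewrite tens_tens; apply: eq_tens => x y; rewrite tens_liftE; last by lin.
by rewrite tens_liftE ?antipode2 //; lin.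
Qed.

(* As [antipode2] makes the square of the antipode inner, this is its inverse. *)
Definition antipodeV h := g * antipode h * g^-1.

Lemma antipodeK : cancel (antipode : H -> H) antipodeV.
Proof.
have gu := grouplike_unit.
by move=> h; rewrite /antipodeV antipode2 -!mulrA mulVKr // divrr // mulr1.
Qed.

Lemma antipodeVK : cancel antipodeV antipode.
Proof.
move=> h; rewrite /antipodeV grouplike_inv !antipodeM !antipode2.
have gu := grouplike_unit.
by rewrite -grouplike_inv mulVr // mul1r -!mulrA mulVKr // divrr // mulr1.
Qed.

Lemma antipode_inj : injective (antipode : H -> H).
Proof. exact: can_inj antipodeK. Qed.

(** Applying S, which reverses products and is injective, turns this into the axiom [antipodel]. *)
Lemma antipodeVl h :
  \sw_(x, y <- comul h) (antipodeV y * x) = (counit h : k) *: 1.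
Proof.
apply: antipode_inj; rewrite linearZ /= antipode1 -antipodel.
rewrite (lin_tens (f := antipode : 'Hom(_, _))); last by lin.
by apply: eq_tens => x y; rewrite antipodeM antipodeVK.
Qed.

Lemma antipode2l h :
  \sw_(x, y <- comul h) (antipode (antipode y) * antipode x) = (counit h : k) *: 1.
Proof.
rewrite -[in RHS]antipode1 -[RHS]linearZ /= -antipoder.
rewrite (lin_tens (f := antipode : 'Hom(_, _))); last by lin.
by apply: eq_tens => x y; rewrite antipodeM.
Qed.

(** The usual left action of [H] on its dual, transpose to right multiplication. *)
Definition shift h f : dual H := linfun (fun x => f (x * h) : k^o).

Lemma shiftE h f x : shift h f x = f (x * h).
Proof. by rewrite linE //; lin. Qed.

(** The Hopf module compatibility behind [integral_proj]. Inserting S^2(y_2) S(y_1) gives x_1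
    S^2(y_2) S(y_1) (x) x_2 S^2(y_3), where S^2(y_2) (x) S^2(y_3) is again a coproduct because S^2
    is a coalgebra map. *)
Lemma mul_shift_antipode2 f p x y :
  \sw_(x1, x2 <- comul x) (f x1 * p (x2 * antipode (antipode y)) : k^o) =
  \sw_(y1, y2 <- comul y)
    ((shift (antipode y1) f * p) (x * antipode (antipode y2)) : k^o).
Proof.
transitivity (\sw_(y1, y2 <- comul y) \sw_(u, v <- comul y2) \sw_(x1, x2 <- comul x)
  (f (x1 * (antipode (antipode u) * antipode y1)) * p (x2 * antipode (antipode v)) : k^o)).
  rewrite -(comulAE (f := fun y1 u v => \sw_(x1, x2 <- comul x)
    (f (x1 * (antipode (antipode u) * antipode y1)) * p (x2 * antipode (antipode v)) : k^o))); lin.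
  rewrite -[y in LHS]counitl (lin_tens (f := fun y => \sw_(x1, x2 <- comul x)
     (f x1 * p (x2 * antipode (antipode y)) : k^o))); lin.
  apply: eq_tens => y1 y2.
  rewrite exchange_tens (linZ (f := fun y => \sw_(x1, x2 <- comul x)
     (f x1 * p (x2 * antipode (antipode y)) : k^o))); lin.
  rewrite -tens_scale; apply: eq_tens => x1 x2; rewrite tens_kmull.
  rewrite -(lin_tens (f := f : 'Hom(_, _))); lin.
  by rewrite tens_mulr antipode2l -scalerAr mulr1 !linearZ /= /GRing.scale /= mulrCA mulrA.
apply: eq_tens => y1 y2; rewrite dualME comulM comul_antipode2 exchange_tens tens_tens.
apply: eq_tens => x1 x2; rewrite !tens_tens; apply: eq_tens => u v.
by rewrite !tens_liftE ?shiftE ?mulrA //; lin.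
Qed.
End Integral.

(** * Dual bases and the product of [dual H] *)

Section DualBasis.
Variables (k : fieldType) (H : hopfType k).

Lemma mul_dual_basisE (i j : 'I_(\dim {:H})) h :
  (dual_basis i * dual_basis j : dual H) h = (comul h : 'M[k]__) i j.
Proof.
rewrite dualME /tens_lift (bigD1 i) //= (bigD1 j) //= !dual_basis_vbasis !eqxx.
rewrite mulr1 !big1 ?addr0 => [|a na|b nb]; first by rewrite /GRing.scale /= mulr1.
  rewrite big1 // => b _.
  by rewrite !dual_basis_vbasis [i == a]eq_sym (negPf na) mul0r scaler0.
by rewrite !dual_basis_vbasis [j == b]eq_sym (negPf nb) mulr0 scaler0.
Qed.

(** For the canonical element sum e_i (x) e^i, comultiplying the first leg amounts to multiplying
    two copies in the second leg. *)
Lemma sum_comul_dual_basis (U : vectType k) (F : H -> H -> dual H -> U) :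
  (forall x y, lin (F x y)) ->
  \sum_(i < \dim {:H}) \sw_(x, y <- comul (vbasis {:H})`_i) F x y (dual_basis i) =
  \sum_(i < \dim {:H}) \sum_(j < \dim {:H}) F (vbasis {:H})`_i (vbasis {:H})`_j (dual_basis i * dual_basis j).
Proof.
move=> lF; rewrite /tens_lift exchange_big; apply: eq_bigr => i _.
rewrite exchange_big; apply: eq_bigr => j _.
rewrite [dual_basis i * dual_basis j]dual_basisE lin_sum //.
by apply: eq_bigr => l _; rewrite (linZ _ _ (lF _ _)) mul_dual_basisE.
Qed.

Lemma sum_counit_dual_basis :
  \sum_(i < \dim {:H}) (counit (vbasis {:H})`_i : k) *: dual_basis i = 1 :> dual H.
Proof. by rewrite -dual_basisE. Qed.
End DualBasis.

(** * Existence of a nonzero left integral on [H] *)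

Section IntegralExistence.
Variables (k : fieldType) (H : hopfType k) (g : H).
Hypothesis g_grouplike : is_grouplike g.
Hypothesis antipode2 : forall h : H, antipode (antipode h) = g^-1 * h * g.
Implicit Types (h x y : H) (f e p : dual H).

(* The projection of the Hopf module [dual H] onto its coinvariants, which are
   the left integrals. *)
Definition integral_proj p : dual H :=
  \sum_(i < \dim {:H}) shift (antipode (antipode (vbasis {:H})`_i)) (dual_basis i * p).

(** At x the sum is f(x_1 S(x_2)), because the dual basis recovers x_2 from its coordinates. *)
Lemma sum_shift_dual_basis f :
  \sum_(i < \dim {:H}) shift (antipode (vbasis {:H})`_i) f * dual_basis i
  = (f 1 : k) *: 1.
Proof.
apply/lfunP => x; rewrite sum_lfunE scale_lfunE dual1E.
transitivity (f ((counit x : k) *: 1)); last by rewrite linearZ /GRing.scale /= mulrC.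
rewrite -antipoder (lin_tens (f := f : 'Hom(_, _))); last by lin.
under eq_bigr => i _ do rewrite dualME.
rewrite -tens_big; apply: eq_tens => y z.
rewrite {2}[z](coord_vbasis (memvf z)) !(linear_sum, mulr_sumr) /=.
by apply: eq_bigr => i _; rewrite shiftE !linearZ -scalerAr linearZ lfunE /GRing.scale /= mulrC.
Qed.

(** [mul_shift_antipode2] splits each basis vector into its coproduct, which [sum_comul_dual_basis]
    trades for a product of two dual basis vectors; the sum over the first index is then f(1) by
    [sum_shift_dual_basis]. *)
Lemma integral_projP p : left_integral_on (integral_proj p).
Proof.
move=> f; apply/lfunP => x.
pose F (y1 y2 : H) (e : dual H) : k^o :=
  (shift (antipode y1) f * (e * p)) (x * antipode (antipode y2)).
transitivity (\sum_(i < \dim {:H}) \sw_(x, y <- comul (vbasis {:H})`_i) F x y (dual_basis i)).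
  rewrite dualME /integral_proj.
  under eq_tens => x1 x2 do rewrite sum_lfunE mulr_sumr.
  rewrite tens_big; apply: eq_bigr => i _.
  by rewrite -(mul_shift_antipode2 g_grouplike antipode2); apply: eq_tens => x1 x2; rewrite shiftE.
rewrite sum_comul_dual_basis; last first.
  by move=> y1 y2; rewrite /F; lin.
rewrite exchange_big /= scale_lfunE /integral_proj sum_lfunE scaler_sumr.
apply: eq_bigr => j _; rewrite /F shiftE -sum_lfunE.
rewrite -[RHS]scale_lfunE; congr (fun_of_lfun _ _).
under eq_bigr => i _ do rewrite -mulrA mulrA.
have l : lin (fun u : dual H => u * (dual_basis j * p)) by lin.
etransitivity; first exact: esym (lin_sum _ _ _ l).
by rewrite sum_shift_dual_basis -scalerAl mul1r.
Qed.

(** Expresses any functional through integrals, as in the structure theorem for Hopf modules. The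
    antipodes combine to S(S(y_1) y_2), which collapses. *)
Lemma integral_proj_sum p :
  \sum_(j < \dim {:H}) shift (antipode (vbasis {:H})`_j) (integral_proj (dual_basis j * p)) = p.
Proof.
apply/lfunP => x.
pose F (y1 y2 : H) (e : dual H) : k^o :=
  (e * p) (x * (antipode y2 * antipode (antipode y1))).
transitivity (\sum_(i < \dim {:H}) \sw_(x, y <- comul (vbasis {:H})`_i) F x y (dual_basis i)).
  rewrite sum_comul_dual_basis; last by move=> y1 y2; rewrite /F; lin.
  rewrite exchange_big sum_lfunE; apply: eq_bigr => j _.
  rewrite shiftE sum_lfunE; apply: eq_bigr => i _.
  by rewrite shiftE /F !mulrA.
have l : lin (fun u : dual H => u * p) by lin.
rewrite -[p in RHS]mul1r -sum_counit_dual_basis (lin_sum _ _ _ l) sum_lfunE.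
apply: eq_bigr => i _; rewrite /F.
under eq_tens => y1 y2 do rewrite -antipodeM.
rewrite -(lin_tens (f := fun u => (dual_basis i * p) (x * antipode u))); last by lin.
by rewrite antipodel -scalerAl scale_lfunE linearZ /= antipode1 -scalerAr mulr1 linearZ.
Qed.

Lemma exists_left_integral_on : exists2 T : dual H, left_integral_on T & T != 0.
Proof.
case: (pickP (fun j : 'I_(\dim {:H}) => integral_proj (dual_basis j * 1) != 0)) => [j nz|z].
  by exists (integral_proj (dual_basis j * 1)) => //; apply: integral_projP.
(* If all these projections vanished, the decomposition of the unit of [dual H] would give 1 = 0. *)
have := oner_neq0 (dual H); rewrite -(integral_proj_sum 1) big1 ?eqxx // => j _.
have /negbFE/eqP -> := z j; apply/lfunP => x; by rewrite shiftE !zero_lfunE.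
Qed.

End IntegralExistence.

(** * Nondegeneracy of left integrals on [H] *)

Section Nondegenerate.
Variables (k : fieldType) (H : hopfType k).
Implicit Types (h x y : H) (f e : dual H).

Lemma counit_antipode h : counit (antipode h) = counit h.
Proof.
rewrite -[h in LHS]counitr (lin_tens (f := antipode : 'Hom(_, _))); last by lin.
rewrite (lin_tens (f := counit : 'Hom(_, _))); last by lin.
transitivity (counit ((counit h : k) *: (1 : H))); last first.
  by rewrite linearZ /= counit1 /GRing.scale /= mulr1.
rewrite -antipodel.
rewrite (lin_tens (f := counit : 'Hom(_, _))); last by lin.
by apply: eq_tens => x y; rewrite counitM !linearZ /= /GRing.scale /= mulrC.
Qed.

Lemma left_integral_onE (T : dual H) z : left_integral_on T ->
  \sw_(x, y <- comul z) ((T y : k) *: x) = (T z : k) *: 1.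
Proof.
move=> iT; apply: dual_ext => f; rewrite linearZ /=.
rewrite (lin_tens (f := f : 'Hom(_, _))); last by lin.
have /lfunP/(_ z) := iT f; rewrite dualME scale_lfunE /GRing.scale /= mulrC => <-.
by apply: eq_tens => x y; rewrite linearZ /GRing.scale /= mulrC.
Qed.

(** Inserting S(x_1) x_2 gives T(x_3 h_2) S(x_1) x_2 h_1, where invariance of T replaces T(x_3 h_2)
    x_2 h_1 by T(x_2 h) 1. *)
Lemma left_integral_on_shift (T : dual H) x h : left_integral_on T ->
  \sw_(h1, h2 <- comul h) ((T (x * h2) : k) *: h1) =
  \sw_(x1, x2 <- comul x) ((T (x2 * h) : k) *: antipode x1).
Proof.
move=> iT.
transitivity (\sw_(x1, x2 <- comul x) \sw_(u, v <- comul x2) \sw_(h1, h2 <- comul h)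
   ((T (v * h2) : k) *: (antipode x1 * (u * h1)))).
  rewrite -(comulAE (f := fun x1 u v => \sw_(h1, h2 <- comul h)
   ((T (v * h2) : k) *: (antipode x1 * (u * h1))))); lin.
  rewrite -[x in LHS]counitl (lin_tens (f := fun x => \sw_(h1, h2 <- comul h)
     ((T (x * h2) : k) *: h1))); lin.
  apply: eq_tens => x1 x2; rewrite exchange_tens.
  rewrite (linZ (f := fun x => \sw_(h1, h2 <- comul h) ((T (x * h2) : k) *: h1))); lin.
  rewrite -tens_scale; apply: eq_tens => h1 h2; rewrite tens_scale.
  under eq_tens => u v do rewrite mulrA.
  by rewrite tens_mull antipodel -scalerAl mul1r scalerA mulrC scalerA.
apply: eq_tens => x1 x2; rewrite -[antipode x1 in RHS]mulr1 scalerAr.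
rewrite -left_integral_onE // comulM tens_tens -tens_mulr; apply: eq_tens => u v.
rewrite tens_tens -tens_mulr; apply: eq_tens => h1 h2.
by rewrite tens_liftE -?scalerAr //; lin.
Qed.

(** If T(- h) vanishes, [left_integral_on_shift] kills T(x h_2) h_1 for all x, hence also T(x S(h_2)
    h_3) h_1, which equals T(x) h. *)
Lemma left_integral_on_inj (T : dual H) h : left_integral_on T -> T != 0 -> shift h T = 0 -> h = 0.
Proof.
move=> iT Tn0 hT0.
(* Stated as a tensor, so that the argument of T may then be made to depend on the other leg. *)
have W0 : \sw_(a, b <- comul h) (shift b T \ox a) = 0 :> tens (dual H) H.
  apply: dual_sep_l => x; rewrite tens_tens.
  transitivity (\sw_(h1, h2 <- comul h) ((T (x * h2) : k) *: h1)).
    by apply: eq_tens => a b; rewrite tens_liftE ?shiftE //; lin.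
  rewrite left_integral_on_shift // /tens_lift !big1 // => i _; rewrite big1 // => j _.
    by rewrite mxE scale0r.
  by rewrite -shiftE hT0 zero_lfunE scale0r scaler0.
have Th0 x : (T x : k) *: h = 0.
  have := congr1 (fun t => \sw_(f, a <- t) \sw_(p, q <- comul a)
    (((f : dual H) (x * antipode q) : k) *: p)) W0.
  rewrite /= tens_tens.
  rewrite (_ : tens_lift 0 _ = 0); last first.
    by rewrite /tens_lift big1 // => i _; rewrite big1 // => j _; rewrite mxE scale0r.
  move=> <-.
  transitivity (\sw_(a, b <- comul h) \sw_(p, q <- comul a)
     ((T (x * (antipode q * b)) : k) *: p)); last first.
    apply: eq_tens => a b; rewrite tens_liftE; last by rewrite /shift; lin.
    by apply: eq_tens => p q; rewrite shiftE mulrA.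
  rewrite (comulAE (f := fun p q b => (T (x * (antipode q * b)) : k) *: p)); lin.
  rewrite -[h in LHS]counitr -tens_scale; apply: eq_tens => a b.
  rewrite -(lin_tens (f := fun u => (T (x * u) : k) *: a)); lin.
  by rewrite antipodel -scalerAr mulr1 [in RHS]linearZ !scalerA mulrC.
apply/eqP; apply: contraNT Tn0 => hn0; apply/eqP/lfunP => x; rewrite zero_lfunE.
by have /eqP := Th0 x; rewrite scaler_eq0 (negPf hn0) orbF => /eqP.
Qed.
End Nondegenerate.

(** * Right integrals in [H]: existence, uniqueness, nondegeneracy *)

Definition right_integral_in (k : fieldType) (H : hopfType k) (t : H) : Prop :=
  forall h : H, t * h = (counit h : k) *: t.

Section RightIntegral.
Variables (k : fieldType) (H : hopfType k) (g : H).
Hypothesis g_distinguished : distinguished_grouplike g.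
Hypothesis antipode2 : forall h : H, antipode (antipode h) = g^-1 * h * g.
Implicit Types (h x y t : H) (f e : dual H).

Let g_grouplike : is_grouplike g := proj1 g_distinguished.

Lemma shift_onto (T : dual H) f :
  left_integral_on T -> T != 0 -> exists h, f = shift h T.
Proof.
move=> iT Tn0.
have lT : lin (fun h => shift h T) by rewrite /shift; lin.
have [||F _ FK] := @lfun_inj_bij k _ _ (linfun (fun h => shift h T)).
- by rewrite dim_dual.
- by move=> h; rewrite linE //; apply: left_integral_on_inj.
by exists (F f); rewrite -[LHS]FK linE.
Qed.

(** The witness is S(l), where T(- l) is the counit: nondegeneracy of T makes l a left integral, and
    S exchanges the two sides. *)
Lemma exists_right_integral (alpha : dual H) : distinguished_char alpha ->
  exists t, [/\ t != 0, right_integral_in t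
    & forall x, x * t = (alpha (antipode x) : k) *: t].
Proof.
case=> [[a1 aM] alphaP].
have [T iT Tn0] := exists_left_integral_on g_grouplike antipode2.
have [l lT] := shift_onto 1 iT Tn0.
have lE y : T (y * l) = counit y by rewrite -shiftE -lT.
have il : left_integral_in l.
  move=> x; apply/eqP; rewrite -subr_eq0; apply/eqP.
  apply: left_integral_on_inj iT Tn0 _; apply/lfunP => y; rewrite zero_lfunE shiftE.
  rewrite mulrBr linearB /= mulrA lE -scalerAr linearZ /= lE counitM.
  by rewrite /GRing.scale /= mulrC subrr.
have gu := grouplike_unit g_grouplike.
(* A character does not see conjugation; this turns alpha(S^-1(x)) into alpha(S(x)). *)
have aS x : alpha (antipode (antipode x)) = alpha x.
  by rewrite antipode2 !aM mulrAC -aM mulVr // a1 mul1r.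
have SK := antipodeVK g_grouplike antipode2.
exists (antipode l); split=> [|h|x].
- apply/eqP => l0; have : l = 0.
    by apply: (antipode_inj g_grouplike antipode2); rewrite l0 linear0.
  move=> l00; have := lE 1; rewrite l00 mulr0 linear0 counit1 => /eqP.
  by rewrite eq_sym oner_eq0.
- by rewrite -[h]SK -antipodeM il linearZ /= counit_antipode.
by rewrite -[x]SK -antipodeM alphaP // linearZ /= aS.
Qed.

(** Inserting h_2 S(h_3) gives t_1 h_1 (x) t_2 h_2 S(h_3), and t h_1 = eps(h_1) t. *)
Lemma right_integral_comul_ox t h : right_integral_in t ->
  \sw_(x, y <- comul t) ((x * h) \ox y) = \sw_(x, y <- comul t) (x \ox (y * antipode h)).
Proof.
move=> it.
transitivity (\sw_(a, b <- comul h) \sw_(u, v <- comul a) \sw_(x, y <- comul t)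
   ((x * u) \ox (y * (v * antipode b)))).
  rewrite (comulAE (f := fun u v b => \sw_(x, y <- comul t)
     ((x * u) \ox (y * (v * antipode b))))); lin.
  rewrite -[h in LHS]counitr (lin_tens (f := fun h => \sw_(x, y <- comul t)
     ((x * h) \ox y))); last by lin.
  apply: eq_tens => a b; rewrite exchange_tens.
  rewrite (linZ (f := fun h => \sw_(x, y <- comul t) ((x * h) \ox y))); last by lin.
  rewrite -tens_scale; apply: eq_tens => x y.
  rewrite -(lin_tens (f := fun u => (x * a) \ox (y * u))); last by lin.
  rewrite antipoder -scalerAr mulr1 (linZ (f := fun u => (x * a) \ox u)) //; lin.
rewrite -[h in RHS]counitl (lin_tens (f := fun h => \sw_(x, y <- comul t)
   (x \ox (y * antipode h)))); last by lin.
apply: eq_tens => a b.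
rewrite (linZ (f := fun h => \sw_(x, y <- comul t) (x \ox (y * antipode h)))); last by lin.
pose G s := \sw_(x, y <- comul s) (x \ox (y * antipode b)).
have lG : lin G by rewrite /G; lin.
rewrite -[\sw_(x, y <- comul t) _ in RHS]/(G t) -linZ // -it /G comulM tens_tens exchange_tens.
apply: eq_tens => x y; rewrite tens_tens; apply: eq_tens => u v.
by rewrite tens_liftE ?mulrA //; lin.
Qed.

Lemma right_integral_comul (U : vectType k) (F : H -> H -> U) t h :
  bilin F -> right_integral_in t ->
  \sw_(x, y <- comul t) F (x * h) y = \sw_(x, y <- comul t) F x (y * antipode h).
Proof.
move=> bF it; have := congr1 (fun s => tens_lift s F) (right_integral_comul_ox h it).
rewrite !tens_tens => e; etransitivity; last (etransitivity; first exact: e).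
  by apply: eq_tens => x y; rewrite tens_liftE.
by apply: eq_tens => x y; rewrite tens_liftE.
Qed.

Lemma distinguished_grouplikeE (T : dual H) z : left_integral_on T ->
  \sw_(x, y <- comul z) ((T x : k) *: y) = (T z : k) *: g.
Proof.
move=> iT; apply: dual_ext => f; rewrite linearZ /=.
rewrite (lin_tens (f := f : 'Hom(_, _))); last by lin.
have /lfunP/(_ z) := (proj2 g_distinguished) T iT f.
rewrite dualME scale_lfunE /GRing.scale /= mulrC => <-.
by apply: eq_tens => x y; rewrite linearZ.
Qed.

(** Moving h to the second leg leaves T(t_1) t_2 = T(t) g. *)
Lemma right_integral_shift (T : dual H) t h : left_integral_on T -> right_integral_in t ->
  \sw_(x, y <- comul t) ((T (x * h) : k) *: y) = (T t : k) *: (g * antipode h).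
Proof.
move=> iT it; rewrite (right_integral_comul (F := fun x y => (T x : k) *: y)) //; last by lin.
rewrite scalerAl -distinguished_grouplikeE // -tens_mull.
by apply: eq_tens => x y; rewrite scalerAl.
Qed.

(* Both sides are proportional to [T t] once [f] is written as [shift h T], and
   the factors agree because [g * antipode h] is mapped to [g^-1 * h] by the
   antipode. *)
Lemma right_integral_nakayama t f e : right_integral_in t ->
  \sw_(x, y <- comul t) (f x * e y : k^o) =
  \sw_(x, y <- comul t) (e x * f (y * antipode g) : k^o).
Proof.
move=> it; have [T iT Tn0] := exists_left_integral_on g_grouplike antipode2.
have [h ->] := shift_onto f iT Tn0.
transitivity (e ((T t : k) *: (g * antipode h))).
  rewrite -right_integral_shift // (lin_tens (f := e : 'Hom(_, _))); last by lin.
  by apply: eq_tens => x y; rewrite shiftE linearZ.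
transitivity (\sw_(x, y <- comul t) ((T y * e (x * (g * antipode h))) : k^o)); last first.
  have gu := grouplike_unit g_grouplike.
  rewrite (right_integral_comul (F := fun x y => (T y * e x : k^o))) //; last by lin.
  apply: eq_tens => x y; rewrite shiftE mulrC antipodeM (antipode2 h).
  by rewrite -(grouplike_inv g_grouplike) -!mulrA divrr // mulr1.
have -> : e ((T t : k) *: (g * antipode h)) = shift (g * antipode h) e ((T t : k) *: 1).
  by rewrite shiftE -scalerAl mul1r.
rewrite -left_integral_onE //.
rewrite (lin_tens (f := shift (g * antipode h) e : 'Hom(_, _))); last by lin.
by apply: eq_tens => x y; rewrite linearZ /= shiftE.
Qed.

(** Any functional is some T(- h), and T(t h) is the counit of T(t) g S(h). *)
Lemma right_integral_eq0 (T : dual H) t :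
  left_integral_on T -> T != 0 -> right_integral_in t -> T t = 0 -> t = 0.
Proof.
move=> iT Tn0 it Tt0; apply: dual_ext => f; rewrite linear0.
have [h ->] := shift_onto f iT Tn0.
have := congr1 counit (right_integral_shift h iT it).
rewrite Tt0 scale0r linear0 => <-.
rewrite (lin_tens (f := counit : 'Hom(_, _))); last by lin.
rewrite -[t in LHS]counitr (lin_tens (f := (shift h T) : 'Hom(_, _))); last by lin.
by apply: eq_tens => x y; rewrite !linearZ /= shiftE /GRing.scale /= mulrC.
Qed.

Lemma right_integral_uniq t t' : t != 0 -> right_integral_in t ->
  right_integral_in t' -> exists c : k, t' = c *: t.
Proof.
move=> tn0 it it'; have [T iT Tn0] := exists_left_integral_on g_grouplike antipode2.
have Tt : T t != 0 by apply: contraNneq tn0 => /(right_integral_eq0 iT Tn0 it) ->.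
exists ((T t' : k) / (T t : k)); apply/eqP; rewrite -subr_eq0; apply/eqP.
apply: right_integral_eq0 iT Tn0 _ _ => [h|].
  by rewrite mulrBl it' -scalerAl it scalerBr !scalerA mulrC.
by rewrite linearB linearZ /= /GRing.scale /= divfK // subrr.
Qed.

(** For f = T(- h), contracting the first leg gives T(t) g S(h), whose vanishing forces h = 0. *)
Lemma right_integral_nondegl t f : t != 0 -> right_integral_in t ->
  (forall e, \sw_(x, y <- comul t) (f x * e y : k^o) = 0) -> f = 0.
Proof.
move=> tn0 it; have [T iT Tn0] := exists_left_integral_on g_grouplike antipode2.
have Tt : T t != 0 by apply: contraNneq tn0 => /(right_integral_eq0 iT Tn0 it) ->.
have [h ->] := shift_onto f iT Tn0 => f0.
have : g * antipode h = 0.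
  suff /eqP : (T t : k) *: (g * antipode h) = 0.
    by rewrite scaler_eq0 (negPf Tt) => /eqP.
  rewrite -right_integral_shift //; apply: dual_ext => e; rewrite linear0 -(f0 e).
  rewrite (lin_tens (f := e : 'Hom(_, _))); last by lin.
  by apply: eq_tens => x y; rewrite linearZ /= shiftE.
have gu := grouplike_unit g_grouplike.
move/(congr1 (fun x => g^-1 * x)); rewrite mulKr // mulr0 => S0.
have -> : h = 0 by apply: (antipode_inj g_grouplike antipode2); rewrite S0 linear0.
by apply/lfunP => x; rewrite shiftE mulr0 linear0 zero_lfunE.
Qed.

Lemma right_integral_nondegr t e : t != 0 -> right_integral_in t ->
  (forall f, \sw_(x, y <- comul t) (f x * e y : k^o) = 0) -> e = 0.
Proof.
move=> tn0 it e0; apply: (right_integral_nondegl tn0 it) => f.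
(* Shifting the test functional by [g] cancels the [antipode g] that [right_integral_nakayama]
   produces. *)
rewrite -(e0 (shift g f)) [RHS](right_integral_nakayama _ _ it).
apply: eq_tens => x y; rewrite shiftE -mulrA.
by rewrite antipode_grouplike_mull // mulr1.
Qed.
End RightIntegral.

(** * Symmetric comodule algebras described by functionals *)

Definition symmetrizing_form (k : fieldType) (L : hopfType k) (u : dual L)
    (B : comodAlgType L) (lam : dual B) : Prop :=
  [/\ forall b : B, (forall c : B, lam (b ** c) = 0) -> b = 0,
      forall b c : B, lam (b ** c) = lam (c ** hact (u \o antipode)%VF b)
    & forall b : B, \sw_(b0, b1 <- coact b) ((lam b0 : k) *: b1) = (lam b : k) *: 1].

Section SymmetricForm.
Variables (k : fieldType) (L : hopfType k) (u : dual L) (B : comodAlgType L).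
Implicit Types (b c : B) (lam : dual B).

(** Insert c_1 S(c_2) and apply coinvariance to the product b c_0. *)
Lemma coinv_form_antipode lam b c :
  (forall b, \sw_(b0, b1 <- coact b) ((lam b0 : k) *: b1) = (lam b : k) *: 1) ->
  \sw_(b0, b1 <- coact b) ((lam (b0 ** c) : k) *: b1) =
  \sw_(c0, c1 <- coact c) ((lam (b ** c0) : k) *: antipode c1).
Proof.
move=> coinv.
transitivity (\sw_(c0, c1 <- coact c) \sw_(p, q <- coact c0) \sw_(b0, b1 <- coact b)
   ((lam (b0 ** p) : k) *: (b1 * (q * antipode c1)))).
  rewrite (coactAE (f := fun p q l => \sw_(b0, b1 <- coact b)
   ((lam (b0 ** p) : k) *: (b1 * (q * antipode l))))); lin.
  rewrite -[c in LHS]coact_counit (lin_tens (f := fun c => \sw_(b0, b1 <- coact b)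
     ((lam (b0 ** c) : k) *: b1))); last by lin.
  apply: eq_tens => c0 c1; rewrite exchange_tens.
  rewrite (linZ (f := fun c => \sw_(b0, b1 <- coact b) ((lam (b0 ** c) : k) *: b1))); last by lin.
  rewrite -tens_scale; apply: eq_tens => b0 b1.
  rewrite tens_scale tens_mulr antipoder -scalerAr mulr1.
  by rewrite !scalerA mulrC.
apply: eq_tens => c0 c1.
rewrite -[antipode c1 in RHS]mul1r scalerAl -coinv coactM tens_tens -tens_mull exchange_tens.
apply: eq_tens => b0 b1; rewrite tens_tens -tens_mull; apply: eq_tens => p q.
by rewrite tens_liftE -?scalerAl ?mulrA //; lin.
Qed.

(** The form is phi(1), and conversely phi(b) = lam(b -). Left linearity amounts to twisted symmetry
    and colinearity to coinvariance; one-sided nondegeneracy gives bijectivity by equality of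
    dimensions. *)
Lemma comod_symmetricP : injective (antipode : L -> L) ->
  comod_symmetric u B <-> exists lam : dual B, symmetrizing_form u lam.
Proof.
move=> Sinj; split=> [[phi [bij_phi phil phir phic]]|[lam [nd tw co]]].
  have phiE b c : phi b c = phi uone (b ** c).
    by rewrite -[b in LHS]umul1b phir dual_ractE.
  exists (phi uone); split=> [b b0|b c|b].
  - apply: (bij_inj bij_phi); rewrite linear0; apply/lfunP => c.
    by rewrite phiE b0 zero_lfunE.
  - by rewrite -phiE -[b in LHS]umulb1 phil dual_lactE.
  (* The coaction on the dual carries an antipode, so colinearity at 1 yields the image of
     coinvariance under S. *)
  apply: Sinj; rewrite (lin_tens (f := antipode : 'Hom(_, _))); last by lin.
  have := congr1 (fun t => \sw_(f0, f1 <- t) (((f0 : dual B) b : k) *: f1)) (phic uone).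
  rewrite /= dual_coactP coact1 tens_tens tens_liftE; last by lin.
  rewrite tens_liftE; last by lin.
  move=> e; rewrite linearZ /= antipode1 -e; apply: eq_tens => b0 b1.
  by rewrite linearZ.
have lphi : lin (dual_ract lam) by rewrite /dual_ract; lin.
exists (linfun (dual_ract lam)); split=> [|b c|b c|b]; rewrite ?linE //.
- apply: lfun_inj_bij => [|b]; first by rewrite dim_dual.
  by rewrite linE // => b0; apply: nd => c; rewrite -dual_ractE b0 zero_lfunE.
- by apply/lfunP => d; rewrite dual_lactE !dual_ractE -umulA tw umulA.
- by apply/lfunP => d; rewrite !dual_ractE umulA.
apply/esym/dual_coact_uniq => c; rewrite tens_tens.
transitivity (\sw_(b0, b1 <- coact b) ((lam (b0 ** c) : k) *: b1)).
  by apply: eq_tens => b0 b1; rewrite tens_liftE ?linE ?dual_ractE //; lin.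
by rewrite coinv_form_antipode //; apply: eq_tens => c0 c1; rewrite dual_ractE.
Qed.
End SymmetricForm.

(** * Functionals on the smash product built from [lam] and [t] *)

Section SmashForm.
Variables (k : fieldType) (H : hopfType k) (A : comodAlgType H).
Implicit Types (a b : A) (f e : dual H) (g h t : H) (lam : dual A).

Definition smash_form lam t : dual (smash A) :=
  linfun (fun s : smash A => \sw_(a, f <- s) (lam a * f t : k^o)).

Lemma smash_formE lam t a f : smash_form lam t (a \ox f) = lam a * f t.
Proof. by rewrite linE ?tens_liftE //; lin. Qed.

(** The factor f(b_1 x) comes from f_1(b_1) f_2(x), the comultiplication of [dual H] being dual to
    the product of [H]. *)
Lemma smash_form_mul lam t a f b e :
  smash_form lam t ((a \ox f : smash A) ** (b \ox e)) =
  \sw_(b0, b1 <- coact b) \sw_(x, y <- comul t) (lam (a ** b0) * (f (b1 * x) * e y) : k^o).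
Proof.
rewrite [_ ** _]smash_mulE.
rewrite (lin_tens (f := smash_form lam t : 'Hom(_, _))); last by lin.
transitivity (\sw_(f1, f2 <- comul f) \sw_(b0, b1 <- coact b) \sw_(x, y <- comul t)
   ((lam (a ** b0) * e y) * (f1 b1 * f2 x) : k^o)).
  apply: eq_tens => f1 f2; rewrite smash_formE dualME.
  rewrite /hact (lin_tens (f := fun c => lam (a ** c))); last by lin.
  rewrite -tens_kmull; apply: eq_tens => b0 b1.
  transitivity (\sw_(x, y <- comul t) (lam (a ** ((f1 b1 : k) *: b0)) * (f2 x * e y) : k^o)).
    by rewrite tens_kmulr.
  apply: eq_tens => x y.
  rewrite (linZ (f := fun c => lam (a ** c))); last by lin.
  by rewrite /GRing.scale /= [RHS]mulrACA [f1 b1 * _]mulrC [e y * _]mulrC.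
rewrite exchange_tens; apply: eq_tens => b0 b1.
rewrite exchange_tens; apply: eq_tens => x y.
by rewrite tens_kmulr comul_dualE -mulrA [e y * _]mulrC.
Qed.

(** This is how elements of [H], viewed as functionals on [dual H], act on the smash product; the
    twist by [g] and coinvariance are both read through it. *)
Lemma ox_shift a f h :
  \sw_(f1, f2 <- comul f) ((f2 h : k) *: (a \ox f1 : smash A)) = a \ox shift h f.
Proof.
have -> : shift h f = \sw_(f1, f2 <- comul f) ((f2 h : k) *: f1).
  apply/lfunP => x; rewrite shiftE -comul_dualE.
  rewrite (lin_tens (f := fun f : dual H => f x)); last by lin.
  by apply: eq_tens => f1 f2; rewrite scale_lfunE /GRing.scale /= mulrC.
rewrite (lin_tens (f := fun f : dual H => a \ox f)); last by lin.
by apply: eq_tens => f1 f2; rewrite (linZ (f := fun f : dual H => a \ox f)) //; lin.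
Qed.

Lemma smash_hact g a f :
  hact (ev g \o antipode)%VF (a \ox f : smash A) = a \ox shift (antipode g) f.
Proof.
rewrite /hact [coact _]smash_coactE tens_tens -ox_shift.
apply: eq_tens => f1 f2; rewrite tens_liftE; last by lin.
by rewrite comp_lfunE evE antipode_dualE.
Qed.

(** Evaluation at h reduces this to f(t h) = eps(h) f(t). *)
Lemma smash_form_coinv t lam (s : smash A) : right_integral_in t ->
  \sw_(s0, s1 <- coact s) ((smash_form lam t s0 : k) *: s1)
  = (smash_form lam t s : k) *: 1.
Proof.
move=> it; apply: (lin_ext
  (f := fun s : smash A => \sw_(s0, s1 <- coact s) ((smash_form lam t s0 : k) *: s1))
  (h := fun s : smash A => (smash_form lam t s : k) *: 1)) => [||a f]; lin.
rewrite [coact _]smash_coactE tens_tens; apply/lfunP => h.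
transitivity (smash_form lam t (a \ox shift h f)).
  rewrite -ox_shift (lin_tens (f := smash_form lam t : 'Hom(_, _))); last by lin.
  rewrite (lin_tens (f := fun f : dual H => f h)); last by lin.
  apply: eq_tens => f1 f2; rewrite tens_liftE; last by lin.
  by rewrite linearZ scale_lfunE /GRing.scale /= mulrC.
rewrite !smash_formE shiftE it linearZ scale_lfunE dual1E /GRing.scale /=.
by rewrite mulrCA mulrC.
Qed.
End SmashForm.

(** * Transfer of symmetrizing forms between [A] and [smash A] *)

Section SmashSymmetric.
Variables (k : fieldType) (H : hopfType k) (g : H) (alpha : dual H).
Hypothesis g_distinguished : distinguished_grouplike g.
Hypothesis antipode2 : forall h : H, antipode (antipode h) = g^-1 * h * g.
Variables (A : comodAlgType H) (t : H).
Hypothesis t_neq0 : t != 0.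
Hypothesis t_integral : right_integral_in t.
Hypothesis t_alpha : forall h : H, h * t = (alpha (antipode h) : k) *: t.
Implicit Types (a b : A) (f e : dual H) (x y h : H) (lam : dual A).

Let g_grouplike : is_grouplike g := proj1 g_distinguished.

(** Counterpart of [coinv_form_antipode]: here S^-1(b_2) b_1 is inserted on the left, an order that
    calls for the inverse antipode. *)
Lemma coinv_form_antipodeV lam a b :
  (forall b, \sw_(b0, b1 <- coact b) ((lam b0 : k) *: b1) = (lam b : k) *: 1) ->
  \sw_(a0, a1 <- coact a) ((lam (b ** a0) : k) *: a1) =
  \sw_(b0, b1 <- coact b) ((lam (b0 ** a) : k) *: antipodeV g b1).
Proof.
move=> coinv; rewrite /antipodeV.
transitivity (\sw_(b0, b1 <- coact b) \sw_(p, q <- coact b0) \sw_(a0, a1 <- coact a)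
   ((lam (p ** a0) : k) *: (antipodeV g b1 * q * a1))); rewrite /antipodeV.
  rewrite (coactAE (f := fun p q l => \sw_(a0, a1 <- coact a)
   ((lam (p ** a0) : k) *: (g * antipode l * g^-1 * q * a1)))); lin.
  rewrite -[b in LHS]coact_counit (lin_tens (f := fun b => \sw_(a0, a1 <- coact a)
     ((lam (b ** a0) : k) *: a1))); last by lin.
  apply: eq_tens => b0 b1; rewrite exchange_tens.
  rewrite (linZ (f := fun b => \sw_(a0, a1 <- coact a) ((lam (b ** a0) : k) *: a1))); last by lin.
  rewrite -tens_scale; apply: eq_tens => a0 a1.
  rewrite tens_scale tens_mull (antipodeVl g_grouplike antipode2) -scalerAl mul1r.
  by rewrite !scalerA mulrC.
apply: eq_tens => b0 b1.
rewrite -[g * _ * _ in RHS]mulr1 scalerAr -coinv coactM tens_tens -tens_mulr.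
apply: eq_tens => p q; rewrite tens_tens -tens_mulr; apply: eq_tens => a0 a1.
by rewrite tens_liftE -?scalerAr ?mulrA //; lin.
Qed.

(** The twist by [g] in the action is the one in [right_integral_nakayama], so the legs of t are
    swapped with no factor left over. *)
Lemma smash_form_twist_eq lam a b f e :
  smash_form lam t ((b \ox e : smash A) **
    hact (ev g \o antipode)%VF (a \ox f : smash A)) =
  \sw_(a0, a1 <- coact a) \sw_(x, y <- comul t) (lam (b ** a0) * (f x * e (a1 * y)) : k^o).
Proof.
rewrite smash_hact smash_form_mul; apply: eq_tens => a0 a1.
pose ea : dual H := linfun (fun x => e (a1 * x) : k^o).
have eaE x : ea x = e (a1 * x) by rewrite linE //; lin.
transitivity (\sw_(x, y <- comul t) (lam (b ** a0) * (ea x * f (y * antipode g)) : k^o)).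
  by apply: eq_tens => x y; rewrite shiftE eaE.
transitivity (\sw_(x, y <- comul t) (lam (b ** a0) * (f x * ea y) : k^o)); last first.
  by apply: eq_tens => x y; rewrite eaE.
by rewrite !tens_kmulr (right_integral_nakayama g_distinguished antipode2 f ea).
Qed.

Lemma symmetrizing_form_smash lam :
  symmetrizing_form alpha lam -> symmetrizing_form (ev g) (smash_form lam t).
Proof.
case=> nd tw co; split; last by move=> s; apply: smash_form_coinv.
- move=> s s0; apply: dual_sep_r => y; apply: nd => b.
  (* Pairing s with every b' # e and using the nondegeneracy of t frees the argument x. *)
  have E b' x : \sw_(a, f <- s) \sw_(b0, b1 <- coact b') (lam (a ** b0) * f (b1 * x) : k^o) = 0.
    pose q : dual H := linfun (fun x => \sw_(a, f <- s) \sw_(b0, b1 <- coact b')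
      (lam (a ** b0) * f (b1 * x) : k^o)).
    have qE z : q z = \sw_(a, f <- s) \sw_(b0, b1 <- coact b')
      (lam (a ** b0) * f (b1 * z) : k^o) by rewrite linE //; lin.
    suff q0 : q = 0 by rewrite -qE q0 zero_lfunE.
    apply: (right_integral_nondegl g_distinguished antipode2 t_neq0 t_integral) => e.
    rewrite -(s0 (b' \ox e)) -[s in RHS]tens_eta.
    rewrite (lin_tens (f := fun s : smash A => smash_form lam t (s ** (b' \ox e)))); last by lin.
    under eq_tens => z w do rewrite qE -tens_kmull.
    rewrite exchange_tens; apply: eq_tens => a f; rewrite smash_form_mul.
    under eq_tens => z w do rewrite -tens_kmull.
    rewrite exchange_tens; apply: eq_tens => b0 b1; apply: eq_tens => z w.
    by rewrite mulrA.
  rewrite (lin_tens (f := fun c => lam (c ** b))); last by lin.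
  (* The free argument is taken to be S(b_2) y, so that b_1 S(b_2) y collapses to y. *)
  transitivity (\sw_(p, q <- coact b) \sw_(a, f <- s) \sw_(b0, b1 <- coact p)
     (lam (a ** b0) * f (b1 * (antipode q * y)) : k^o)); last first.
    rewrite (_ : 0 = \sw_(p, q <- coact b) (0 : k^o)); last first.
      by rewrite /tens_lift !big1 // => i _; rewrite big1 // => j _; rewrite scaler0.
    by apply: eq_tens => p q; rewrite E.
  rewrite exchange_tens; apply: eq_tens => a f.
  rewrite (coactAE (f := fun b0 u v => (lam (a ** b0) * f (u * (antipode v * y)) : k^o))); lin.
  rewrite -[b in LHS]coact_counit.
  rewrite (lin_tens (f := fun b => lam (((f y : k) *: a) ** b))); last by lin.
  apply: eq_tens => b0 b1; rewrite tens_kmulr.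
  under [in RHS]eq_tens => u v do rewrite mulrA.
  rewrite -(lin_tens (f := fun z => f (z * y))); last by lin.
  rewrite antipoder -scalerAl mul1r [in RHS]linearZ.
  rewrite (linZ (f := fun b => lam (((f y : k) *: a) ** b))); last by lin.
  rewrite (linZ (f := fun c => lam (c ** b0))); last by lin.
  by rewrite /GRing.scale /= mulrA mulrC.
move=> s s'.
apply: (lin_ext (f := fun s : smash A => smash_form lam t (s ** s'))
  (h := fun s : smash A => smash_form lam t (s' ** hact (ev g \o antipode)%VF s)))
  => [||a f]; lin.
apply: (lin_ext (f := fun s' : smash A => smash_form lam t ((a \ox f : smash A) ** s'))
  (h := fun s' : smash A => smash_form lam t (s' ** hact (ev g \o antipode)%VF (a \ox f : smash A))))
  => [||b e]; lin.
rewrite smash_form_twist_eq smash_form_mul.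
pose G h : k^o := \sw_(x, y <- comul t) (f x * e (h * y) : k^o).
have lG : lin G by rewrite /G; lin.
(* The right side is lam(b a_0) G(a_1); [coinv_form_antipodeV] moves the coaction from a to b. *)
transitivity (\sw_(b0, b1 <- coact b) (lam (b0 ** a) * G (antipodeV g b1) : k^o)); last first.
  have := congr1 G (coinv_form_antipodeV a b co).
  rewrite !(lin_tens (f := G)) // => e1.
  transitivity (\sw_(a0, a1 <- coact a) G ((lam (b ** a0) : k) *: a1)).
    by rewrite e1; apply: eq_tens => b0 b1; rewrite linZ.
  by apply: eq_tens => a0 a1; rewrite linZ // /G -tens_scale.
(* Twisted symmetry of [lam] exchanges b_0 and a, at the cost of a factor alpha^-1. *)
transitivity (\sw_(b0, b1 <- coact b) \sw_(p, q <- coact b0)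
   (lam (a ** p) * ((alpha (antipode q) : k) * G (antipodeV g b1)) : k^o)); last first.
  apply: eq_tens => b0 b1; rewrite tw /hact.
  rewrite (lin_tens (f := fun c => lam (a ** c))); last by lin.
  rewrite -tens_kmull; apply: eq_tens => p q.
  rewrite (linZ (f := fun c => lam (a ** c))); last by lin.
  by rewrite comp_lfunE mulrA [_ * alpha _]mulrC.
rewrite /antipodeV.
rewrite (coactAE (f := fun p q l => (lam (a ** p) * 
   ((alpha (antipode q) : k) * G (g * antipode l * g^-1)) : k^o))); lin.
apply: eq_tens => b0 b1; rewrite !tens_kmulr; congr (_ * _).
(* The scalar alpha^-1(u) is absorbed as u t; then S^-1(v) cancels against the second leg of u. *)
transitivity (\sw_(u, v <- comul b1) \sw_(p, q <- comul u) \sw_(x, y <- comul t)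
   (f (p * x) * e (antipodeV g v * (q * y)) : k^o)); last first.
  apply: eq_tens => u v; rewrite /G.
  pose K h : k^o := \sw_(x, y <- comul h) (f x * e (antipodeV g v * y) : k^o).
  have lK : lin K by rewrite /K; lin.
  rewrite -[\sw_(x, y <- comul t) _ in RHS]/(K t) -[RHS]linZ // -t_alpha /K comulM tens_tens.
  apply: eq_tens => p q; rewrite tens_tens; apply: eq_tens => x y.
  by rewrite tens_liftE //; lin.
rewrite /antipodeV (comulAE (f := fun p q v => \sw_(x, y <- comul t)
   (f (p * x) * e (g * antipode v * g^-1 * (q * y)) : k^o))); lin.
rewrite -[b1 in LHS]counitr (lin_tens (f := fun h => \sw_(x, y <- comul t)
   (f (h * x) * e y : k^o))); last by lin.
apply: eq_tens => p q; rewrite exchange_tens.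
rewrite (linZ (f := fun h => \sw_(x, y <- comul t) (f (h * x) * e y : k^o))); last by lin.
rewrite -tens_scale; apply: eq_tens => x y; rewrite tens_kmulr.
under [in RHS]eq_tens => u v do rewrite mulrA.
rewrite -(lin_tens (f := fun z => e (z * y))); last by lin.
rewrite (antipodeVl g_grouplike antipode2) -scalerAl mul1r [in RHS]linearZ.
by rewrite /GRing.scale /= mulrCA.
Qed.

(** For fixed a, the map f -> Lam(a # f) is evaluation at some r(a) in [H]. Coinvariance makes r(a)
    a right integral, so it is a multiple of t. *)
Lemma coinv_smash_form (Lam : dual (smash A)) :
  (forall s : smash A, \sw_(s0, s1 <- coact s) ((Lam s0 : k) *: s1) = (Lam s : k) *: 1) ->
  exists lam, Lam = smash_form lam t.
Proof.
move=> co.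
pose r a : H := \sum_(i < \dim {:H}) (Lam (a \ox dual_basis i) : k) *: (vbasis {:H})`_i.
have rE a f : f (r a) = Lam (a \ox f).
  rewrite /r linear_sum [f in RHS]dual_basisE.
  rewrite (lin_sum (f := fun f : dual H => Lam (a \ox f))); last by lin.
  apply: eq_bigr => i _; rewrite (linZ (f := fun f : dual H => Lam (a \ox f))); last by lin.
  by rewrite linearZ /GRing.scale /= mulrC.
have r_integral a : right_integral_in (r a).
  move=> h; apply: dual_ext => f; rewrite linearZ /= rE -shiftE rE -ox_shift.
  have /lfunP/(_ h) := co (a \ox f).
  rewrite scale_lfunE dual1E /GRing.scale /= mulrC => <-.
  rewrite [coact _]smash_coactE tens_tens.
  rewrite (lin_tens (f := Lam : 'Hom(_, _))); last by lin.
  rewrite (lin_tens (f := fun f : dual H => f h)); last by lin.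
  apply: eq_tens => f1 f2; rewrite tens_liftE; last by lin.
  by rewrite linearZ scale_lfunE /GRing.scale /= mulrC.
have [f0 f0t] := exists_dual_eq1 t_neq0.
(* As f0(t) = 1, this reads off the coefficient of r(a) along t. *)
exists (linfun (fun a => Lam (a \ox f0))).
apply/lfunP => s.
apply: (lin_ext (f := Lam : smash A -> k^o)
   (h := smash_form (linfun (fun a => Lam (a \ox f0))) t)) => [||a f]; lin.
rewrite smash_formE linE; last by lin.
have [c rc] := right_integral_uniq g_distinguished antipode2 t_neq0 t_integral (r_integral a).
by rewrite -!rE rc !linearZ /= f0t /GRing.scale /= mulr1.
Qed.

Lemma symmetrizing_form_unsmash lam :
  symmetrizing_form (ev g) (smash_form lam t) -> symmetrizing_form alpha lam.
Proof.
case=> nd tw _; have [f0 f0t] := exists_dual_eq1 t_neq0.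
have tw1 a b : lam (a ** b) = lam (b ** hact (alpha \o antipode)%VF a).
  (* With the counit in one slot, the sums over the coproduct of t collapse to f0(t) = 1 on one side
     and to f0(a_1 t) = alpha^-1(a_1) on the other. *)
  have := tw (b \ox f0) (a \ox (1 : dual H)).
  rewrite smash_form_twist_eq smash_form_mul => e.
  transitivity (\sw_(b0, b1 <- coact b) \sw_(x, y <- comul t)
     (lam (a ** b0) * (f0 x * (1 : dual H) (b1 * y)) : k^o)).
    rewrite -[b in LHS]coact_counit.
    rewrite (lin_tens (f := fun b => lam (a ** b))); last by lin.
    apply: eq_tens => b0 b1; rewrite tens_kmulr.
    rewrite (linZ (f := fun b => lam (a ** b))); last by lin.
    rewrite /GRing.scale /= mulrC; congr (_ * _).
    transitivity (\sw_(x, y <- comul t) (counit b1 * f0 ((counit y : k) *: x) : k^o)).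
      rewrite tens_kmulr -(lin_tens (f := f0 : 'Hom(_, _))); last by lin.
      by rewrite counitr f0t mulr1.
    apply: eq_tens => x y.
    by rewrite linearZ dual1E counitM [RHS]mulrC -mulrA.
  etransitivity; first exact: esym e.
  rewrite /hact (lin_tens (f := fun c => lam (b ** c))); last by lin.
  apply: eq_tens => a0 a1; rewrite tens_kmulr.
  rewrite (linZ (f := fun c => lam (b ** c))); last by lin.
  rewrite comp_lfunE /GRing.scale /= mulrC; congr (_ * _).
  transitivity (f0 ((alpha (antipode a1) : k) *: t)); last first.
    by rewrite linearZ /= f0t /GRing.scale /= mulr1.
  rewrite -t_alpha.
  rewrite -[t in RHS]counitr (lin_tens (f := fun z => f0 (a1 * z))); last by lin.
  apply: eq_tens => x y.
  by rewrite -scalerAr linearZ dual1E /GRing.scale /= mulrC.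
split=> // [a a0|a].
  (* The smash form takes the value lam(a b) e(t) on (a # 1)(b # e), so a # 1 lies in its
     radical. *)
  have e0 : (a \ox (1 : dual H) : smash A) = 0.
    apply: nd => s.
    apply: (lin_ext (f := fun s : smash A => smash_form lam t ((a \ox (1 : dual H) : smash A) ** s))
      (h := fun s : smash A => 0 : k^o)) => [||b e]; try by lin.
      by move=> c u v; rewrite scaler0 addr0.
    rewrite [_ ** _]smash_mulE comul1 tens_liftE; last by lin.
    by rewrite smash_formE a0 mul0r.
  have := congr1 (fun s : smash A => \sw_(a, f <- s) (((f : dual H) 1 : k) *: a)) e0.
  rewrite /= tens_liftE; last by lin.
  rewrite dual1E counit1 scale1r => ->.
  by rewrite /tens_lift big1 // => i _; rewrite big1 // => j _; rewrite mxE scale0r.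
apply: dual_ext => e.
(* Coinvariance of [lam] comes from twisted symmetry: applied to a # f and 1 # e it gives f(t_1)
   q(t_2) = 0 for all f, whence q = 0, and q(1) = 0 is coinvariance tested on e. *)
pose q : dual H := linfun (fun y => lam a * e y
  - \sw_(a0, a1 <- coact a) (lam a0 * e (a1 * y)) : k^o).
have qE y : q y = lam a * e y - \sw_(a0, a1 <- coact a) (lam a0 * e (a1 * y) : k^o).
  rewrite linE // => c u v.
  have lq1 : lin (fun y => lam a * e y : k^o) by lin.
  have lq2 : lin (fun y => \sw_(a0, a1 <- coact a) (lam a0 * e (a1 * y) : k^o)) by lin.
  by rewrite lq1 lq2 scalerBr addrACA opprD.
have q0 : q = 0.
  apply: (right_integral_nondegr g_distinguished antipode2 t_neq0 t_integral) => f.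
  have := tw (a \ox f) (uone \ox e).
  rewrite smash_form_twist_eq smash_form_mul coact1 tens_liftE; last by lin.
  rewrite umulb1 => e1.
  transitivity (\sw_(x, y <- comul t) (lam a * (f (1 * x) * e y)
     - \sw_(a0, a1 <- coact a) (lam (uone ** a0) * (f x * e (a1 * y)) : k^o) : k^o)).
    apply: eq_tens => x y; rewrite qE mulrBr mul1r mulrCA; congr (_ - _).
    transitivity (\sw_(a0, a1 <- coact a) (f x * (lam a0 * e (a1 * y)) : k^o)).
      by rewrite tens_kmulr.
    by apply: eq_tens => a0 a1; rewrite umul1b mulrCA.
  by rewrite tens_sub e1 exchange_tens subrr.
have := qE 1; rewrite q0 zero_lfunE => /esym/eqP; rewrite subr_eq0 => /eqP e1.
rewrite (lin_tens (f := e : 'Hom(_, _))); last by lin.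
rewrite [RHS]linearZ [RHS]e1; apply: eq_tens => a0 a1.
by rewrite linearZ mulr1.
Qed.
End SmashSymmetric.

(** * The equivalence, by translating both sides into forms *)

Theorem theorem4p2 (k : fieldType) (H : hopfType k) (g : H) (alpha : dual H)
    (hg : distinguished_grouplike g) (halpha : distinguished_char alpha)
    (hS2g : forall h : H, antipode (antipode h) = g^-1 * h * g)
    (hS2alpha : forall h : H, antipode (antipode h) =
       \sw_(h1, h23 <- comul h) \sw_(h2, h3 <- comul h23)
         ((alpha (antipode h1) * alpha h3 : k) *: h2))
    (A : comodAlgType H) :
  comod_symmetric alpha A <-> comod_symmetric (ev g) (smash A).
Proof.
have injS := antipode_inj (proj1 hg) hS2g.
(* The antipode of [dual H] is the transpose of S, which is surjective. *)
have injSd : injective (antipode : dual H -> dual H).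
  move=> f e fe; apply/lfunP => x.
  by rewrite -[x](antipodeVK (proj1 hg) hS2g) -!antipode_dualE fe.
have [t [tn0 it ta]] := exists_right_integral hg hS2g halpha.
split.
  case/(comod_symmetricP _ _ injS) => lam lamP; apply/(comod_symmetricP _ _ injSd).
  by exists (smash_form lam t); apply: (symmetrizing_form_smash hg).
case/(comod_symmetricP _ _ injSd) => Lam LamP; apply/(comod_symmetricP _ _ injS).
have [_ _ co] := LamP; have [lam LamE] := coinv_smash_form hg hS2g tn0 it co.
by exists lam; rewrite LamE in LamP; apply: (symmetrizing_form_unsmash hg hS2g tn0 it).
Qed.
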